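(* Let $W$ be a centered real-valued random variable such that $\mathbb{E}[|W|^3]\le M\cdot \mathbb{E}[W^2]<\infty$ for some $M>0$. Then, for any positive integer $n$ and independent copies $W_1,\dots,W_n$ of $W$, \[ \mathbb{P}\!\left(\frac1n\sum_{i=1}^n W_i \le \frac{2M}{n}\right)\ge \frac12 . \] In particular, the assumption (and hence the conclusion) holds whenever $W$ is centered and $|W|\le M$ almost surely. *)

(* Defs.v *)
From HB Require Import structures.
From mathcomp Require Import all_boot all_order all_algebra.
From mathcomp Require Import all_classical all_reals all_analysis.
Set Implicit Arguments. Unset Strict Implicit. Unset Printing Implicit Defensive.
Import Order.TTheory GRing.Theory Num.Theory.
Local Open Scope classical_set_scope.
Local Open Scope ring_scope.

(* Mutual independence of a finite family of real random variables X_0..X_{n-1}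
   on a probability space: for every family of Borel sets B_i,
   P(/\_i X_i \in B_i) = prod_i P(X_i \in B_i).  (Taking B_i = setT for the
   indices outside a subfamily gives the product rule for every subfamily.) *)
Definition mutually_independent_rv {d : measure_display} {T : measurableType d}
  {R : realType} (P : probability T R) (n : nat) (X : 'I_n -> T -> R) : Prop :=
  forall B : 'I_n -> set R, (forall i, measurable (B i)) ->
    P (\bigcap_(i in [set: 'I_n]) (X i @^-1` B i)) =
    (\prod_(i < n) P (X i @^-1` B i))%E.

Definition same_distribution {d : measure_display} {T : measurableType d}
  {d' : measure_display} {T' : measurableType d'} {R : realType}
  (P : probability T R) (W : T -> R) (Q : probability T' R) (Y : T' -> R) : Prop :=
  forall B : set R, measurable B -> Q (Y @^-1` B) = P (W @^-1` B).

(* Main.v *)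
Require Import Defs.
From HB Require Import structures.
From mathcomp Require Import all_boot all_order all_algebra.
From mathcomp Require Import all_classical all_reals all_analysis.
From mathcomp Require Import measurable_realfun ring lra.
Import Order.TTheory GRing.Theory Num.Theory.
Import numFieldNormedType.Exports.
Local Open Scope classical_set_scope.
Local Open Scope ring_scope.
Set Implicit Arguments. Unset Strict Implicit. Unset Printing Implicit Defensive.

(* Write [S] for the sum, [s^2] for its variance, [m3+] and [m3-] for the third
   moments of the positive and negative parts of [W] divided by its variance, so
   that [m3+ + m3- <= M].  Stein's identity compares [E S h(S)] with
   [s^2 E h'(S)], one summand at a time.

   - If [h'] is nondecreasing and [L]-Lipschitz, then
     [E S h(S) <= s^2 E h'(S) + L/2 * s^2 * m3+].  For the Stein solution of
     [x |x|], which involves the Mills ratio, this bounds [E S|S|], hence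
     [E S_+^2 <= s^2/2 + O(s * m3+)].
   - For the indicator [h' = 1_{x > 2M}] the comparison fails by at most a multiple
     of the density [E(S; S > 2M)]:
     [s^2 P(S > 2M) <= E S(S - 2M)_+ + (2M - 3/2 m3+) E(S; S > 2M)].

   Hence [s^2 P(S > 2M) <= E(S^2 - 3/2 m3+ S; S > 2M)], and the gain of
   [3/2 m3+ E(S; S > 2M)] outweighs the error [O(s * m3+)]: if the probability
   exceeded 1/2, this would force [M] and [E S_+] to be small multiples of [s],
   against the lower bound on [E S_+] obtained by interpolating [E S_+^2] between
   [E S_+] and [E S_+^3]. *)

(** The comparisons for one summand contain products such as [variance2 mu * Ex mu k], which are
    bilinear in the law. Each is obtained by averaging a pointwise inequality in two copies [x], [y]
    of the summand, where centering removes the terms that are linear in one copy.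

    The obstacle is the indicator. The other summands move the threshold to an arbitrary real [tau],
    so the comparison must hold at all of them, and its error must be a multiple of E(S; S >
    threshold), which for a Gaussian is the variance times the density at the threshold. A jump at 0
    added to the primitive produces such an error and is enough for [tau >= 0]. For [tau < 0] it is
    not: a rare, very negative value of [W] breaks the inequality. A bounded correction is then
    added, whose derivative is the deficit divided by the variance, so that Stein's comparison
    applied to the correction returns the deficit to first order. *)

Section real_expectation.
Context (d : measure_display) (T : measurableType d) (R : realType).
Variable P : probability T R.
Implicit Types f g : T -> R.

Definition rint f := P.-integrable setT (EFin \o f).
Definition Ex f : R := \int[P]_x f x.

Lemma rint_dom f g : measurable_fun setT f -> rint g ->
  (forall x, `|f x| <= g x) -> rint f.
Proof.
move=> mf ig fg; apply: le_integrable ig => //; first exact/measurable_EFinP.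
by move=> x _; rewrite /= lee_fin (le_trans (fg x))// ler_norm.
Qed.

Lemma rint_cst c : rint (fun=> c).
Proof. exact: finite_measure_integrable_cst. Qed.

Lemma rintD f g : rint f -> rint g -> rint (fun x => f x + g x).
Proof. by move=> i_f i_g; have := integrableD measurableT i_f i_g. Qed.

Lemma rintZ c f : rint f -> rint (fun x => c * f x).
Proof. by move=> i_f; have := integrableZl measurableT c i_f. Qed.

Lemma rint_sum (I : Type) (s : seq I) (F : I -> T -> R) :
  (forall i, rint (F i)) -> rint (fun x => \sum_(i <- s) F i x).
Proof.
move=> iF; elim: s => [|i s IH].
  by under eq_fun do rewrite big_nil; exact: rint_cst.
by under eq_fun do rewrite big_cons; exact: rintD.
Qed.

Lemma Ex_cst c : Ex (fun=> c) = c.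
Proof. by rewrite /Ex Rintegral_cst//= probability_setT mulr1. Qed.

Lemma ExD f g : rint f -> rint g -> Ex (fun x => f x + g x) = Ex f + Ex g.
Proof. exact: RintegralD. Qed.

Lemma ExZ c f : rint f -> Ex (fun x => c * f x) = c * Ex f.
Proof. exact: RintegralZl. Qed.

Lemma Ex_sum (I : Type) (s : seq I) (F : I -> T -> R) :
  (forall i, rint (F i)) ->
  Ex (fun x => \sum_(i <- s) F i x) = \sum_(i <- s) Ex (F i).
Proof.
move=> iF; elim: s => [|i s IH].
  by rewrite big_nil; under eq_fun do rewrite big_nil; rewrite Ex_cst.
rewrite big_cons -IH -ExD//; last exact: rint_sum.
by congr Ex; apply/funext => x; rewrite big_cons.
Qed.

Lemma Ex_ge0 f : (forall x, 0 <= f x) -> 0 <= Ex f.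
Proof. by move=> f0; exact: Rintegral_ge0. Qed.

Fixpoint all_rint (s : seq (R * (T -> R))) : Prop :=
  if s is p :: s' then rint p.2 /\ all_rint s' else True.

Lemma rint_lin s : all_rint s -> rint (fun x => \sum_(p <- s) p.1 * p.2 x).
Proof.
elim: s => [_|p s IH [ip /IH is_]].
  by under eq_fun do rewrite big_nil; exact: rint_cst.
by under eq_fun do rewrite big_cons; apply: rintD => //; exact: rintZ.
Qed.

Lemma Ex_lin s : all_rint s ->
  Ex (fun x => \sum_(p <- s) p.1 * p.2 x) = \sum_(p <- s) p.1 * Ex p.2.
Proof.
elim: s => [_|p s IH [ip is_]].
  by rewrite big_nil; under eq_fun do rewrite big_nil; rewrite Ex_cst.
rewrite big_cons -IH// -ExZ// -ExD; [|exact: rintZ|exact: rint_lin].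
by congr Ex; apply/funext => x; rewrite big_cons.
Qed.

(* Linear pointwise inequalities are integrated in this form, so that the
   integrability side conditions appear one summand at a time. *)
Lemma Ex_lin_ge0 s : all_rint s ->
  (forall x, 0 <= \sum_(p <- s) p.1 * p.2 x) -> 0 <= \sum_(p <- s) p.1 * Ex p.2.
Proof. by move=> ip s0; rewrite -Ex_lin//; exact: Ex_ge0. Qed.

Lemma Ex_le f g : rint f -> rint g -> (forall x, f x <= g x) -> Ex f <= Ex g.
Proof. by move=> i_f i_g fg; apply: le_Rintegral. Qed.

End real_expectation.

(** * Polynomial growth as a certificate of integrability *)

Section growth.
Context (d : measure_display) (T : measurableType d) (R : realType).
Variable b : T -> R.
Hypothesis b_ge1 : forall x, 1 <= b x.
Implicit Types f g : T -> R.

(** The weight [b] will be [1 + |x|] on the line and one plus the sum of the [|X i|] on the sample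
    space. Degrees are tracked because third moments are all that is available: a product is
    integrable once its degrees add up to at most 3. *)
Definition grow (j : nat) f := measurable_fun setT f /\
  exists2 a, 0 <= a & forall x, `|f x| <= a * b x ^+ j.

Let b_ge0 x : 0 <= b x. Proof. exact: le_trans (b_ge1 x). Qed.

Lemma growW i j f : (i <= j)%N -> grow i f -> grow j f.
Proof.
move=> ij [mf [a a0 fa]]; split=> //; exists a => // x.
by rewrite (le_trans (fa x))// ler_wpM2l// ler_weXn2l.
Qed.

Lemma grow_cst c : grow 0 (fun=> c).
Proof. by split=> //; exists `|c| => // x; rewrite expr0 mulr1. Qed.

Lemma growD j f g : grow j f -> grow j g -> grow j (fun x => f x + g x).
Proof.
move=> [mf [a a0 fa]] [mg [c c0 gc]]; split; first exact: measurable_funD.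
exists (a + c); first exact: addr_ge0.
by move=> x; rewrite mulrDl (le_trans (ler_normD _ _))// lerD.
Qed.

Lemma growM i j f g : grow i f -> grow j g -> grow (i + j) (fun x => f x * g x).
Proof.
move=> [mf [a a0 fa]] [mg [c c0 gc]]; split; first exact: measurable_funM.
exists (a * c); first exact: mulr_ge0.
by move=> x; rewrite normrM exprD mulrACA ler_pM.
Qed.

Lemma growX i j f : grow i f -> grow (j * i) (fun x => f x ^+ j).
Proof.
move=> [mf [a a0 fa]]; split; first exact: measurable_funX.
exists (a ^+ j); first exact: exprn_ge0.
by move=> x; rewrite normrX mulnC exprM -exprMn lerXn2r// nnegrE mulr_ge0// exprn_ge0.
Qed.

Lemma growZ j c f : grow j f -> grow j (fun x => c * f x).
Proof. exact: growM (grow_cst c). Qed.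

Lemma growN j f : grow j f -> grow j (fun x => - f x).
Proof.
by move=> /(growZ (-1)); under eq_fun do rewrite mulN1r.
Qed.

Lemma growB j f g : grow j f -> grow j g -> grow j (fun x => f x - g x).
Proof. by move=> gf /growN; exact: growD. Qed.

Lemma grow_dom j f g : measurable_fun setT f -> grow j g ->
  (forall x, `|f x| <= `|g x|) -> grow j f.
Proof.
move=> mf [mg [a a0 ga]] fg; split=> //; exists a => // x.
exact: le_trans (fg x) (ga x).
Qed.

Lemma grow_max0 j f : grow j f -> grow j (fun x => Num.max (f x) 0).
Proof.
move=> gf; apply: (grow_dom _ gf); last first.
  by move=> x; rewrite /Order.max; case: ifP; rewrite ?normr0.
by apply: measurable_maxr => //; case: gf.
Qed.

Lemma grow_gt0 j f : grow j f -> grow 0 (fun x => (0 < f x)%R%:R).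
Proof.
move=> [mf _]; split; last first.
  by exists 1 => // x; rewrite expr0 mulr1; case: (0 < f x); rewrite ?normr1 ?normr0.
rewrite [X in measurable_fun _ X](_ : _ = \1_(f @^-1` `]0, +oo[)).
  by apply: measurable_indic; rewrite -[_ @^-1` _]setTI; exact: mf.
by apply/funext => x; rewrite indicE; congr (nat_of_bool _)%:R; apply/idP/idP;
  rewrite inE /= in_itv/= andbT.
Qed.

Lemma grow_rint (P : probability T R) j f :
  rint P (fun x => b x ^+ 3) -> (j <= 3)%N -> grow j f -> rint P f.
Proof.
move=> b3 j3 /(growW j3)[mf [a a0 fa]].
by apply: (rint_dom mf (rintZ a b3)).
Qed.

End growth.

(** * Positive and negative parts, and convex functions with Lipschitz derivative *)

Section parts.
Context (R : realType).
Implicit Types x : R.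

Definition posp x := Num.max x 0.
Definition negp x := Num.max (- x) 0.

Lemma posp_case x : (0 <= x /\ posp x = x) \/ (x < 0 /\ posp x = 0).
Proof.
by case: (leP 0 x) => x0; [left|right]; split=> //;
  [exact/max_idPl|exact/max_idPr/ltW].
Qed.

Lemma negp_case x : (0 <= x /\ negp x = 0) \/ (x < 0 /\ negp x = - x).
Proof.
by case: (leP 0 x) => x0; [left|right]; split=> //;
  [apply/max_idPr|apply/max_idPl]; lra.
Qed.

Lemma posp_ge0 x : 0 <= posp x.
Proof. by rewrite /posp le_max lexx orbT. Qed.

Lemma negp_ge0 x : 0 <= negp x.
Proof. by rewrite /negp le_max lexx orbT. Qed.

Lemma gt0_case x : (0 < x /\ (0 < x)%R%:R = 1 :> R) \/
  (x <= 0 /\ (0 < x)%R%:R = 0 :> R).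
Proof. by case: ltP; [left|right]. Qed.

End parts.

(* [h' = k] with [k] nondecreasing and [L]-Lipschitz, in integrated form. *)
Record c1_convex (R : realType) (h k : R -> R) (L : R) : Prop := C1Convex {
  c1_le : forall x y, x <= y -> k x <= k y ;
  c1_lip : forall x y, x <= y -> k y - k x <= L * (y - x) ;
  c1_taylor : forall x y, x <= y -> h y - h x <= k x * (y - x) + L / 2 * (y - x) ^+ 2 ;
  c1_tangent : forall x y, h x - h y <= k x * (x - y) }.

Section c1_convex_theory.
Context (R : realType) (h k : R -> R) (L : R).
Hypothesis hk : c1_convex h k L.

Lemma c1_convex_shift v : c1_convex (fun x => h (v + x)) (fun x => k (v + x)) L.
Proof.
split=> [x y xy|x y xy|x y xy|x y].
- by apply: (c1_le hk); rewrite lerD2l.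
- by have := c1_lip hk (x := v + x) (y := v + y); rewrite lerD2l => /(_ xy); lra.
- have := c1_taylor hk (x := v + x) (y := v + y); rewrite lerD2l => /(_ xy).
  by rewrite (_ : v + y - (v + x) = y - x)//; ring.
- have := c1_tangent hk (v + x) (v + y).
  by rewrite (_ : v + x - (v + y) = x - y)//; ring.
Qed.

(* For opposite signs the increment of [h] is split at [x + y]. *)
Let swap_le x y : x <= y ->
  h y - h x + x * k y - y * k x <= L / 2 * (posp y ^+ 2 - posp x ^+ 2).
Proof.
move=> xy.
have kxy := c1_le hk xy; have lxy := c1_lip hk xy.
have [[x0 ->]|[x0 ->]] := posp_case x; have [[y0 ->]|[y0 ->]] := posp_case y.
- by have := c1_taylor hk xy; nra.
- by lra.
- have xyx : x <= x + y by lra.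
  have := c1_taylor hk xyx; have := c1_tangent hk y (x + y).
  rewrite (_ : x + y - x = y); last by ring.
  by rewrite (_ : y - (x + y) = - x); [nra|ring].
- by have := c1_tangent hk y x; nra.
Qed.

(** Averaged over two independent centered copies, [(x - y) * (h x - h y)] gives twice E(x h(x)),
    [(x - y) * (y * k x - x * k y)] gives minus twice the variance times E(k), and the squared
    positive parts give twice the third moment of [posp]. The factor [x - y] makes the expression
    symmetric, so that only [x <= y] has to be treated. *)
Lemma c1_convex_swap x y :
  0 <= (x - y) * (L / 2 * (posp x ^+ 2 - posp y ^+ 2) -
                   (h x - h y + y * k x - x * k y)).
Proof.
have [xy|/ltW yx] := leP x y.
  by rewrite mulr_le0// ?subr_le0//; have := swap_le xy; lra.
by rewrite mulr_ge0// ?subr_ge0// swap_le.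
Qed.

Lemma c1_lip_ge0 : 0 <= L.
Proof. by have := c1_lip hk ler01; have := c1_le hk ler01; lra. Qed.

Lemma c1_grow_k : measurable_fun setT k -> grow (fun x : R => 1 + `|x|) 1 k.
Proof.
move=> mk; split=> //; have L0 := c1_lip_ge0.
exists (`|k 0| + L); first by rewrite addr_ge0.
move=> x; rewrite expr1.
have : `|k x| <= `|k 0| + L * `|x|.
  have := ler_norm (k 0); have := ler_norm (- k 0); rewrite normrN => Nk0 k0.
  have [x0|x0] := leP 0 x.
  - have := c1_lip hk x0; have := c1_le hk x0; rewrite (ger0_norm x0).
    by rewrite ler_norml => ? ?; apply/andP; split; lra.
  - have := c1_lip hk (ltW x0); have := c1_le hk (ltW x0); rewrite (ltr0_norm x0).
    by rewrite ler_norml => ? ?; apply/andP; split; lra.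
by have := normr_ge0 x; have := normr_ge0 (k 0); nra.
Qed.

Lemma c1_grow_h : measurable_fun setT h -> grow (fun x : R => 1 + `|x|) 2 h.
Proof.
move=> mh; split=> //; have L0 := c1_lip_ge0.
exists (`|h 0| + `|k 0| + L); first by rewrite !addr_ge0.
move=> x.
have kx0 := c1_tangent hk x 0; have k0x := c1_tangent hk 0 x.
have : `|h x| <= `|h 0| + `|k 0| * `|x| + L * `|x| ^+ 2.
  have : h x - h 0 <= k 0 * x + L * x ^+ 2.
    rewrite subr0 in kx0; have [x0|/ltW x0] := leP 0 x.
    - by have := c1_lip hk x0; nra.
    - by have := c1_lip hk x0; nra.
  rewrite real_normK ?num_real// -normrM => hx0.
  have := ler_norm (h 0); have := ler_norm (- h 0); rewrite normrN.
  have := ler_norm (k 0 * x); have := ler_norm (- (k 0 * x)); rewrite normrN.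
  have Lx : 0 <= L * x ^+ 2 by rewrite mulr_ge0// sqr_ge0.
  by rewrite ler_norml => ? ? ? ?; apply/andP; split; lra.
have := normr_ge0 x; have := normr_ge0 (k 0); have := normr_ge0 (h 0).
move: `|x| `|k 0| `|h 0| => a b c c0 b0 a0 /le_trans; apply.
have : 0 <= c * a by rewrite mulr_ge0.
have : 0 <= b * a by rewrite mulr_ge0.
have : 0 <= L * a by rewrite mulr_ge0.
have : 0 <= a * a by rewrite mulr_ge0.
move=> aa La ba ca; rewrite !expr2.
have : 0 <= (b + c) * (a * a) by rewrite mulr_ge0// addr_ge0.
by lra.
Qed.

End c1_convex_theory.

(** * The law of one summand and its moments *)

Section law.
Context (R : realType) (mu : probability R R).
Hypothesis mu3 : rint mu (fun x => `|x| ^+ 3).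
Local Notation E := (Ex mu).
Local Notation I := (rint mu).
Local Notation G := (grow (fun x : R => 1 + `|x|)).

Definition variance2 := E (fun x => x ^+ 2).
Definition pos3 := E (fun x => posp x ^+ 3).
Definition neg3 := E (fun x => negp x ^+ 3).

Lemma law_b1 (x : R) : 1 <= 1 + `|x|. Proof. by rewrite lerDl. Qed.

Lemma law_b3 : I (fun x => (1 + `|x|) ^+ 3).
Proof.
apply: (@rint_dom _ _ _ mu _ (fun x : R => 4 + 4 * `|x| ^+ 3)).
- by apply: measurable_funX; exact: measurable_funD.
- by apply: rintD; [exact: rint_cst|exact: rintZ].
- move=> x; rewrite ger0_norm ?exprn_ge0 ?addr_ge0//.
  have := normr_ge0 x; move: `|x| => a a0.
  rewrite -subr_ge0 (_ : _ - _ = 3 * (1 + a) * (1 - a) ^+ 2); last by ring.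
  by apply: mulr_ge0; [lra|exact: sqr_ge0].
Qed.

Lemma law_int j f : (j <= 3)%N -> G j f -> I f.
Proof. by move=> j3; exact: (grow_rint law_b1 law_b3). Qed.

Lemma law_id : G 1 (fun x => x).
Proof.
split=> //; exists 1 => // x; rewrite expr1 mul1r; have := normr_ge0 x; lra.
Qed.

Lemma law_pos : G 1 (@posp R).
Proof. exact: grow_max0 law_id. Qed.

Lemma law_neg : G 1 (@negp R).
Proof. exact: grow_max0 (growN law_id). Qed.

End law.

(** * Bilinear inequalities from two copies *)

Section pairs.
Context (d : measure_display) (T : measurableType d) (R : realType).
Variable P : probability T R.

Fixpoint all_rint2 (s : seq (R * (T -> R) * (T -> R))) : Prop :=
  if s is p :: s' then [/\ rint P p.1.2, rint P p.2 & all_rint2 s'] else True.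

(* Integrating against two independent copies without a product measure. *)
Lemma Ex_pair_ge0 s : all_rint2 s ->
  (forall x y, 0 <= \sum_(p <- s) p.1.1 * p.1.2 x * p.2 y) ->
  0 <= \sum_(p <- s) p.1.1 * Ex P p.1.2 * Ex P p.2.
Proof.
move=> is_ s0.
pose s2 := [seq (p.1.1 * Ex P p.1.2, p.2) | p <- s].
have -> : \sum_(p <- s) p.1.1 * Ex P p.1.2 * Ex P p.2 =
    \sum_(p <- s2) p.1 * Ex P p.2 by rewrite big_map.
apply: Ex_lin_ge0 => [|y]; first by elim: s {s0} is_ @s2 => //= p s IH [? ? /IH].
pose s1 := [seq (p.1.1 * p.2 y, p.1.2) | p <- s].
have -> : \sum_(p <- s2) p.1 * p.2 y = \sum_(p <- s1) p.1 * Ex P p.2.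
  by rewrite !big_map; apply: eq_bigr => p _ /=; ring.
apply: Ex_lin_ge0 => [|x]; first by elim: s {s0} is_ @s2 @s1 => //= p s IH [? ? /IH].
rewrite big_map; under eq_bigr => p _ do rewrite /= mulrAC.
exact: s0.
Qed.

(** Cauchy-Schwarz, with [v ^+ 2 <= u * w] replaced by its symmetrized two-point form. This keeps
    square roots out of every application. *)
Lemma Ex_cauchy (u v w : T -> R) : rint P u -> rint P v -> rint P w ->
  (forall x y, 2 * v x * v y <= u x * w y + u y * w x) ->
  Ex P v ^+ 2 <= Ex P u * Ex P w.
Proof.
move=> iu iv iw uvw.
have := @Ex_pair_ge0 [:: (1, u, w); (1, w, u); (-2, v, v)].
rewrite !big_cons !big_nil /= => H.
suff : 0 <= 1 * Ex P u * Ex P w +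
   (1 * Ex P w * Ex P u + (-2 * Ex P v * Ex P v + 0)) by nra.
apply: H => // x y; rewrite !big_cons !big_nil /=.
by have := uvw x y; lra.
Qed.

End pairs.

(** * The smooth comparison for one summand *)

Section law_inequalities.
Context (R : realType) (mu : probability R R).
Hypothesis mu3 : rint mu (fun x => `|x| ^+ 3).
Hypothesis mu0 : Ex mu (fun x => x) = 0.
Local Notation E := (Ex mu).
Local Notation I := (rint mu).
Local Notation G := (grow (fun x : R => 1 + `|x|)).
Local Notation b1 := (@law_b1 R).

Lemma posp3E (x : R) : posp x ^+ 3 = x * posp x ^+ 2.
Proof. by have [[_ ->]|[_ ->]] := posp_case x; ring. Qed.

Lemma law_swap h k L : measurable_fun setT h -> measurable_fun setT k ->
  c1_convex h k L ->
  E (fun x => x * h x) <= variance2 mu * E k + L / 2 * pos3 mu.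
Proof.
move=> mh mk hk.
have gh := c1_grow_h hk mh; have gk := c1_grow_k hk mk.
have gp := @law_pos R; have gi := @law_id R.
have iI j f : G j f -> (j <= 3)%N -> I f by move=> + j3; exact: law_int.
have ih : I h by exact: (iI _ _ gh).
have ik : I k by exact: (iI _ _ gk).
have ii : I (fun x => x) by exact: (iI _ _ gi).
have ixh : I (fun x => x * h x) by exact: (iI _ _ (growM gi gh)).
have ixk : I (fun x => x * k x) by exact: (iI _ _ (growM gi gk)).
have ip2 : I (fun x => posp x ^+ 2) by exact: (iI _ _ (growX b1 2 gp)).
have ip3 : I (fun x => posp x ^+ 3) by exact: (iI _ _ (growX b1 3 gp)).
have ix2 : I (fun x => x ^+ 2) by exact: (iI _ _ (growX b1 2 gi)).
have i1 : I (fun=> 1) by exact: rint_cst.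
(* The list is the expansion of [c1_convex_swap]; the terms with a bare factor [x] or [y] vanish by
   centering, and the others pair up by symmetry. *)
have := @Ex_pair_ge0 _ _ _ mu [:: (L / 2, fun x => posp x ^+ 3, fun=> 1);
  (- (L / 2), fun x => x, fun x => posp x ^+ 2); (1, fun x => x, h);
  (-1, fun x => x, fun x => x * k x); (- (L / 2), fun x => posp x ^+ 2, fun x => x);
  (L / 2, fun=> 1, fun x => posp x ^+ 3); (-1, fun=> 1, fun x => x * h x);
  (-1, fun x => x * h x, fun=> 1); (-1, fun x => x * k x, fun x => x);
  (1, fun x => x ^+ 2, k); (1, h, fun x => x); (1, k, fun x => x ^+ 2)].
rewrite /= !big_cons !big_nil /= Ex_cst mu0 => H.
suff : 0 <= 2 * (variance2 mu * E k + L / 2 * pos3 mu - E (fun x => x * h x)) by lra.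
rewrite /variance2 /pos3; apply: le_trans (H _ _) _ => //.
  move=> x y; rewrite !big_cons !big_nil /=.
  by have := c1_convex_swap hk x y; rewrite !posp3E; lra.
by lra.
Qed.

End law_inequalities.

(** * Two-point inequalities for nonnegative thresholds *)

Section pair_inequalities.
Context (R : realType).
Variable tau : R.
Hypothesis tau0 : 0 <= tau.
Let i (x : R) : R := (0 < x - tau)%R%:R.
Let l (x : R) : R := (0 < 0 - x)%R%:R.

Let three_cases x : [\/ [/\ tau < x, i x = 1, l x = 0 & posp x = x],
  [/\ 0 <= x <= tau, i x = 0, l x = 0 & posp x = x] |
  [/\ x < 0, i x = 0, l x = 1 & posp x = 0]].
Proof.
have t0 := tau0.
have i0 z : z <= tau -> i z = 0.
  by move=> zt; rewrite /i; have [[? _]|[? ->]//] := gt0_case (z - tau); lra.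
have l0 z : 0 <= z -> l z = 0.
  by move=> z0; rewrite /l; have [[? _]|[? ->]//] := gt0_case (0 - z); lra.
have [x0|x0] := ltP x 0.
  apply: Or33; split=> //; [by apply: i0; lra| |exact/max_idPr/ltW].
  by rewrite /l; have [[? ->]//|[? _]] := gt0_case (0 - x); lra.
have px : posp x = x by exact/max_idPl.
have [xt|xt] := ltP tau x; [apply: Or31|apply: Or32]; split=> //; try by [apply: l0|apply: i0|lra].
by rewrite /i; have [[? ->]//|[? _]] := gt0_case (x - tau); lra.
Qed.

(** Bounds P(x > tau) times the second moment of [posp]. With [z] above [tau] and [p] in [[0, tau]]
    the expression is [(z - p) * p + (z - tau) * z]; with both points above [tau] the squares cancel
    and [(x - tau) * y + (y - tau) * x] remains. *)
Lemma pair_second_moment x y :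
  0 <= i x * (x * posp y - tau * x - posp y ^+ 2 + x ^+ 2) +
       i y * (y * posp x - tau * y - posp x ^+ 2 + y ^+ 2).
Proof.
have t0 := tau0.
have sgt z p : tau < z -> 0 <= p <= tau -> 0 <= z * p - tau * z - p ^+ 2 + z ^+ 2.
  move=> tz /andP[p0 pt]; have : 0 <= (z - p) * p by rewrite mulr_ge0; lra.
  have : 0 <= (z - tau) * z by rewrite mulr_ge0; lra.
  by lra.
case: (three_cases x) => -[xt -> _ ->]; case: (three_cases y) => -[yt -> _ ->];
  rewrite ?mul0r ?mul1r ?addr0 ?add0r//; try by apply: sgt => //; rewrite lexx.
have : 0 <= (x - tau) * y by rewrite mulr_ge0; lra.
have : 0 <= (y - tau) * x by rewrite mulr_ge0; lra.
by lra.
Qed.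

(** On average, P(x > tau) E(x_+) is at most E(x; x > tau) P(x >= 0): values above [tau] dominate
    the nonnegative values at or below it, and two values above [tau] cancel. The factor P(x >= 0)
    is the gain used in [tail_pos]. *)
Lemma pair_first_moment x y :
  0 <= i x * (x - posp y - x * l y) + i y * (y - posp x - y * l x).
Proof.
have t0 := tau0.
by case: (three_cases x) => -[? -> -> ->]; case: (three_cases y) => -[? -> -> ->]; lra.
Qed.

(** The two-point form for (E x_-)^2 <= E(x_-^2) P(x < 0), whose factor is complementary to that of
    [pair_first_moment]. *)
Lemma pair_cauchy x y :
  2 * negp x * negp y <= negp x ^+ 2 * l y + negp y ^+ 2 * l x.
Proof.
have lcase z : (z < 0 /\ l z = 1) \/ (0 <= z /\ l z = 0).
  by rewrite /l; have [[? ->]|[? ->]] := gt0_case (0 - z); [left|right]; split=> //; lra.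
have [[? ->]|[? ->]] := lcase x; have [[? ->]|[? ->]] := lcase y;
  have [[? ->]|[? ->]] := negp_case x; have [[? ->]|[? ->]] := negp_case y;
  have := sqr_ge0 (x - y); lra.
Qed.

End pair_inequalities.

(* [jump n] is the primitive vanishing at [0] of [r |-> n * (n - r)_+] on [r >= 0]. *)
Definition jump (R : realType) (n r : R) := n * (n ^+ 2 - posp (n - posp r) ^+ 2) / 2.

(** * Two-point inequalities for negative thresholds *)

Section jump_inequalities.
Context (R : realType).
Implicit Types n r t x y : R.

Lemma jump_bounds n r : 0 <= n -> 0 <= jump n r <= n ^+ 3 / 2.
Proof.
move=> n0; rewrite /jump.
have r0 := posp_ge0 r; have q0 := posp_ge0 (n - posp r).
have qn : posp (n - posp r) <= n by rewrite /posp ge_max n0 andbT gerBl.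
have q2 : 0 <= n * (n ^+ 2 - posp (n - posp r) ^+ 2).
  by rewrite mulr_ge0// subr_ge0 lerXn2r.
have : 0 <= n * posp (n - posp r) ^+ 2 by rewrite mulr_ge0// sqr_ge0.
by move=> ?; apply/andP; split; lra.
Qed.

Lemma jump_le0 n r : 0 <= n -> r <= 0 -> jump n r = 0.
Proof.
move=> n0 r0; rewrite /jump /posp (max_idPr r0) subr0 (max_idPl n0).
by rewrite subrr mulr0 mul0r.
Qed.

Lemma jump_homo n : 0 <= n -> {homo jump n : r s / r <= s}.
Proof.
move=> n0 r s rs; rewrite /jump ler_pM2r// ler_wpM2l// lerB// lerXn2r ?nnegrE ?posp_ge0//.
by rewrite /posp ge_max !le_max lexx orbT andbT lerB ?orTb// ge_max !le_max rs lexx ?orbT.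
Qed.

Let le_case n t : (t <= n /\ (t <= n)%R%:R = 1 :> R) \/ (n < t /\ (t <= n)%R%:R = 0 :> R).
Proof. by case: (leP t n); [left|right]. Qed.

Let scale_le (c x y : R) : 0 <= c -> x <= y -> c * x <= c * y.
Proof. by move=> c0; exact: ler_wpM2l. Qed.

(** First-order expansion of [jump n] at [t], where its slope is [n * posp (n - t)]. On the half
    line [jump n] is concave with second derivative at least [- n]: a step to the right costs the
    cubic term, and only if [t <= n], while a step to the left costs nothing as long as it stays in
    the half line. Beyond 0 the function is flat, and the product of the two overshoots accounts for
    that stretch. *)
Lemma jump_tangent n t x : 0 <= n -> 0 <= t ->
  x ^+ 2 * (n * posp (n - t)) - posp x ^+ 3 * (n * (t <= n)%R%:R) / 2
    - negp x * posp (negp x - t) * (n * posp (n - t))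
  <= x * (jump n (x + t) - jump n t).
Proof.
move=> n0 t0; have tE : posp t = t by exact/max_idPl.
rewrite /jump tE.
have [xpos|xneg] := leP 0 x.
  have -> : negp x = 0 by apply/max_idPr; lra.
  have -> : posp x = x by exact/max_idPl.
  have -> : posp (x + t) = x + t by apply/max_idPl; lra.
  rewrite !mul0r subr0; have xn : 0 <= x * n / 2 by rewrite divr_ge0// mulr_ge0.
  have [[tn ->]|[nt ->]] := le_case n t; last first.
    have -> : posp (n - t) = 0 by apply/max_idPr; lra.
    have -> : posp (n - (x + t)) = 0 by apply/max_idPr; lra.
    by lra.
  have -> : posp (n - t) = n - t by apply/max_idPl; lra.
  have : 2 * (n - t) * x - x ^+ 2 <= (n - t) ^+ 2 - posp (n - (x + t)) ^+ 2.
    have [[? ->]|[? ->]] := posp_case (n - (x + t)); first by lra.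
    by have := sqr_ge0 (n - t - x); lra.
  by move=> /(scale_le xn); lra.
have -> : negp x = - x by apply/max_idPl; lra.
have -> : posp x = 0 by apply/max_idPr; lra.
have xn : 0 <= - x * n / 2 by rewrite divr_ge0// mulr_ge0//; lra.
have [[xt ->]|[xt ->]] := posp_case (- x - t).
  have -> : posp (x + t) = 0 by apply/max_idPr; lra.
  rewrite subr0; have -> : posp n = n by exact/max_idPl.
  have : 2 * t * posp (n - t) <= n ^+ 2 - posp (n - t) ^+ 2.
    have [[? ->]|[? ->]] := posp_case (n - t); last by have := sqr_ge0 n; lra.
    by have := sqr_ge0 t; lra.
  by move=> /(scale_le xn); lra.
have -> : posp (x + t) = x + t by apply/max_idPl; lra.
have : 2 * - x * posp (n - t) <= posp (n - (x + t)) ^+ 2 - posp (n - t) ^+ 2.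
  have [[? ->]|[? ->]] := posp_case (n - t); last by have := sqr_ge0 (posp (n - (x + t))); lra.
  have -> : posp (n - (x + t)) = n - (x + t) by apply/max_idPl; lra.
  by have := sqr_ge0 x; lra.
by move=> /(scale_le xn); lra.
Qed.

(** The two-point hypothesis of [Ex_cauchy] for [D ^+ 2 <= neg3 mu * q0] in [tail_neg]. When both
    indicators are 1, a factor [n * m] comes out and [2 * (n - t) * (m - t) <= n ^+ 2 + m ^+ 2] is
    left. *)
Lemma pair_jump n m t : 0 <= n -> 0 <= m -> 0 <= t ->
  2 * (n * posp (n - t)) * (m * posp (m - t)) <=
  n ^+ 3 * (m * (t <= m)%R%:R) + m ^+ 3 * (n * (t <= n)%R%:R).
Proof.
move=> n0 m0 t0; have nm : 0 <= n * m by rewrite mulr_ge0.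
have [[? ->]|[? ->]] := le_case n t; last first.
  have -> : posp (n - t) = 0 by apply/max_idPr; lra.
  by rewrite !(mulr0, mul0r) addr0 mulr_ge0 ?mulr_ge0// exprn_ge0.
have [[? ->]|[? ->]] := le_case m t; last first.
  have -> : posp (m - t) = 0 by apply/max_idPr; lra.
  by rewrite !(mulr0, mul0r) add0r mulr1 mulr_ge0// exprn_ge0.
have -> : posp (n - t) = n - t by apply/max_idPl; lra.
have -> : posp (m - t) = m - t by apply/max_idPl; lra.
have : 2 * (n - t) * (m - t) <= n ^+ 2 + m ^+ 2.
  have := sqr_ge0 (n - m); have : 0 <= t * (n + m - t) by rewrite mulr_ge0//; lra.
  by lra.
by move=> /(scale_le nm); lra.
Qed.

End jump_inequalities.

(** * The indicator comparison for one summand *)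

Section law_tail.
Context (R : realType) (mu : probability R R).
Hypothesis mu3 : rint mu (fun x => `|x| ^+ 3).
Hypothesis mu0 : Ex mu (fun x => x) = 0.
Hypothesis var_gt0 : 0 < variance2 mu.
Local Notation E := (Ex mu).
Local Notation I := (rint mu).
Local Notation G := (grow (fun x : R => 1 + `|x|)).
Local Notation b1 := (@law_b1 R).

(** On [r >= 0] its derivative is E(y_- (y_- - r)_+) divided by the variance. The numerator is
    exactly the amount by which E(x (x + r)_+) falls short of the variance. *)
Definition jumpE (r : R) := E (fun y => jump (negp y) r) / variance2 mu.

(* [tail] replaces the primitive [posp] of the indicator so that [law_tail] holds
   at every threshold; its excess over [posp] stays below [2 * neg3 + pos3 / 2]
   over the variance, which leaves [3/2 * pos3] out of [2 * (neg3 + pos3)]. *)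
Definition atom := (3 / 2 * neg3 mu + 1 / 2 * pos3 mu) / variance2 mu.

Definition tail (r : R) := posp r + atom * (0 < r)%R%:R + jumpE r.

Let iI j f : G j f -> (j <= 3)%N -> I f.
Proof. by move=> + j3; exact: law_int. Qed.

Let gi : G 1 (fun x => x) := @law_id R.
Let gp : G 1 (@posp R) := @law_pos R.
Let gn : G 1 (@negp R) := @law_neg R.

Let in3 : I (fun x => negp x ^+ 3). Proof. exact: (iI (growX b1 3 gn)). Qed.
Let in2 : I (fun x => negp x ^+ 2). Proof. exact: (iI (growX b1 2 gn)). Qed.
Let in1 : I (fun x => negp x). Proof. exact: (iI gn). Qed.
Let ip3 : I (fun x => posp x ^+ 3). Proof. exact: (iI (growX b1 3 gp)). Qed.
Let ip2 : I (fun x => posp x ^+ 2). Proof. exact: (iI (growX b1 2 gp)). Qed.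
Let ip1 : I (fun x => posp x). Proof. exact: (iI gp). Qed.
Let ix2 : I (fun x => x ^+ 2). Proof. exact: (iI (growX b1 2 gi)). Qed.
Let ix1 : I (fun x => x). Proof. exact: (iI gi). Qed.
Let i1 : I (fun=> 1). Proof. exact: rint_cst. Qed.

Let g1 c : G 1 (fun=> c).
Proof. exact: (growW b1 _ (grow_cst _ _)). Qed.

Let ijump r : I (fun y => jump (negp y) r).
Proof.
apply: iI (_ : G 3 _) _ => //.
apply: (grow_dom (g := fun y => negp y ^+ 3 / 2)).
- apply: measurable_funM => //; apply: measurable_funM; first by case: gn.
  apply: measurable_funB; first by apply: measurable_funX; case: gn.
  apply: measurable_funX; apply: measurable_maxr => //.
  by apply: measurable_funB => //; case: gn.
- exact: (growM (growX b1 3 gn) (grow_cst _ _)).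
- move=> y; have /andP[j0 jn] := jump_bounds r (negp_ge0 y).
  by rewrite !ger0_norm// divr_ge0// exprn_ge0// negp_ge0.
Qed.

Lemma jumpE_bounds r : 0 <= jumpE r <= neg3 mu / variance2 mu / 2.
Proof.
have jb y := andP (jump_bounds r (negp_ge0 y)).
apply/andP; split.
  by rewrite divr_ge0 ?(ltW var_gt0)//; apply: Ex_ge0 => y; case: (jb y).
rewrite /jumpE mulrAC ler_pM2r ?invr_gt0// mulrC -ExZ//.
apply: Ex_le => //; first exact: rintZ.
by move=> y; rewrite mulrC; case: (jb y).
Qed.

Lemma jumpE_le0 r : r <= 0 -> jumpE r = 0.
Proof.
move=> r0; rewrite /jumpE (_ : (fun _ => _) = fun=> 0) ?Ex_cst ?mul0r//.
by apply/funext => y; rewrite jump_le0// negp_ge0.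
Qed.

Lemma measurable_jumpE : measurable_fun setT jumpE.
Proof.
apply: nondecreasing_measurable => // r s rs.
rewrite ler_pM2r ?invr_gt0//; apply: Ex_le => // y.
by apply: jump_homo => //; exact: negp_ge0.
Qed.

Lemma atom_ge0 : 0 <= atom.
Proof.
rewrite divr_ge0 ?(ltW var_gt0)// addr_ge0// mulr_ge0// ?divr_ge0//;
  by apply: Ex_ge0 => x; rewrite exprn_ge0// ?negp_ge0// posp_ge0.
Qed.

Lemma tail_le r : tail r <=
  posp r + (2 * neg3 mu + 1 / 2 * pos3 mu) / variance2 mu * (0 < r)%R%:R.
Proof.
rewrite /tail -addrA lerD2l; have /andP[_] := jumpE_bounds r.
have [[r0 ->]|[r0 ->]] := gt0_case r; last by rewrite (jumpE_le0 r0) !mulr0 addr0.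
by rewrite /atom; lra.
Qed.

Lemma tail_ge0 r : 0 <= tail r.
Proof.
have /andP[j0 _] := jumpE_bounds r.
by rewrite /tail !addr_ge0 ?posp_ge0// mulr_ge0// atom_ge0.
Qed.

Lemma measurable_tail : measurable_fun setT tail.
Proof.
apply: measurable_funD; last exact: measurable_jumpE.
apply: measurable_funD; first by case: gp.
by apply: measurable_funM => //; case: (grow_gt0 gi).
Qed.

Lemma grow_tail : G 1 tail.
Proof.
apply: (grow_dom measurable_tail (g := fun r => posp r +
   (2 * neg3 mu + 1 / 2 * pos3 mu) / variance2 mu * (0 < r)%R%:R)).
  apply: growD; first exact: gp.
  apply: growZ; apply: (growW b1 (i := 0)) => //; exact: (grow_gt0 gi).
by move=> r; rewrite !ger0_norm ?tail_le ?tail_ge0// (le_trans (tail_ge0 r) (tail_le r)).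
Qed.

Let itau tau : G 0 (fun x => (0 < x - tau)%R%:R).
Proof. exact: (grow_gt0 (growB gi (g1 tau))). Qed.

Let moment3 (f : R -> R) : G 1 f -> (forall x, 0 <= f x) ->
  E (fun x => f x ^+ 2) ^+ 2 <= E (fun x => f x ^+ 3) * E f.
Proof.
move=> gf f0; apply: Ex_cauchy.
- exact: (iI (growX b1 3 gf)).
- exact: (iI (growX b1 2 gf)).
- exact: (iI gf).
move=> x y; rewrite -subr_ge0.
rewrite (_ : _ - _ = f x * f y * (f x - f y) ^+ 2); last by ring.
by rewrite mulr_ge0 ?sqr_ge0// mulr_ge0.
Qed.

Let mean_parts : E (@negp R) = E (@posp R).
Proof.
have := @Ex_lin _ _ _ mu [:: (1, @posp R); (-1, @negp R)].
rewrite /= !big_cons !big_nil /= => H.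
apply/eqP; rewrite -subr_eq0 -oppr_eq0; apply/eqP.
rewrite -mu0; transitivity (1 * E (@posp R) + (-1 * E (@negp R) + 0)); first by ring.
rewrite -H//; congr Ex; apply/funext => x; rewrite !big_cons big_nil /=.
by have [[? ->]|[? ->]] := posp_case x; have [[? ->]|[? ->]] := negp_case x; lra.
Qed.

Let variance_parts :
  variance2 mu = E (fun x => negp x ^+ 2) + E (fun x => posp x ^+ 2).
Proof.
rewrite -ExD//; congr Ex; apply/funext => x.
by have [[? ->]|[? ->]] := posp_case x; have [[? ->]|[? ->]] := negp_case x; lra.
Qed.

Let rint_tail tau : I (fun x => x * tail (x - tau)).
Proof.
have gs : G 1 (fun x => tail (x - tau)).
  have [mt [a a0 ta]] := grow_tail; split.
    by apply: measurableT_comp => //; exact: measurable_funB.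
  exists (a * (1 + `|tau|)); first by rewrite mulr_ge0// addr_ge0.
  move=> x; rewrite (le_trans (ta _))// !expr1 -mulrA ler_wpM2l//.
  have := ler_normB x tau; have := normr_ge0 x; have := normr_ge0 tau.
  by move=> t0 x0; have := mulr_ge0 t0 x0; lra.
exact: (iI (growM gi gs)).
Qed.

Let tail_ge_quadratic x tau : 0 <= tau ->
  (x ^+ 2 + (atom - tau) * x) * (0 < x - tau)%R%:R <= x * tail (x - tau).
Proof.
move=> tau0; have /andP[j0 _] := jumpE_bounds (x - tau); rewrite /tail.
have [[xt ->]|[xt ->]] := gt0_case (x - tau).
  rewrite /posp (max_idPl (ltW xt)).
  have : 0 <= x * jumpE (x - tau) by rewrite mulr_ge0//; lra.
  by lra.
by rewrite (jumpE_le0 xt) /posp (max_idPr xt) !mulr0 !addr0 mulr0.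
Qed.

(** The variance is split into [X2 + Y2]. [pair_second_moment] handles [Y2 * A] and leaves a debt
    [m * Q]; what remains is to pay [X2 * A + m * Q] with the jump term [atom * Q]. The correction
    [jumpE] is only used through its sign. *)
Let tail_pos tau : 0 <= tau ->
  variance2 mu * E (fun x => (0 < x - tau)%R%:R) <=
  E (fun x => x * tail (x - tau)).
Proof.
move=> tau0.
pose i (x : R) : R := (0 < x - tau)%R%:R.
pose l (x : R) : R := (0 < 0 - x)%R%:R.
have gI : G 0 i := itau tau.
have gl : G 0 l by exact: (grow_gt0 (growB (g1 0) gi)).
have ii : I i by exact: (iI gI).
have il : I l by exact: (iI gl).
have ixi : I (fun x => x * i x) by exact: (iI (growM gi gI)).
have ix2i : I (fun x => x ^+ 2 * i x) by exact: (iI (growM (growX b1 2 gi) gI)).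
set A := E i; set Q := E (fun x => x * i x); set T2 := E (fun x => x ^+ 2 * i x).
set m := E (@posp R); set X2 := E (fun x => negp x ^+ 2).
set Y2 := E (fun x => posp x ^+ 2); set b := E l.
have m0 : 0 <= m by apply: Ex_ge0 => x; exact: posp_ge0.
have Q0 : 0 <= Q.
  by apply: Ex_ge0 => x; rewrite /i; have [[? ->]|[? ->]] := gt0_case (x - tau); lra.
have X0 : 0 <= X2 by apply: Ex_ge0 => x; exact: sqr_ge0.
have AY : A * Y2 <= m * Q + T2 - tau * Q.
  have := @Ex_pair_ge0 _ _ _ mu [:: (1, fun x => x * i x, @posp R);
    (- tau, fun x => x * i x, fun=> 1); (-1, i, fun x => posp x ^+ 2);
    (1, fun x => x ^+ 2 * i x, fun=> 1); (1, @posp R, fun x => x * i x);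
    (-1, fun x => posp x ^+ 2, i); (1, fun=> 1, fun x => x ^+ 2 * i x);
    (- tau, fun=> 1, fun x => x * i x)].
  rewrite /= !big_cons !big_nil /= Ex_cst -/A -/Q -/T2 -/m -/Y2 => H.
  suff : 0 <= 2 * (m * Q + T2 - tau * Q - A * Y2) by lra.
  apply: le_trans (H _ _) _ => //; last by lra.
  move=> x y; rewrite !big_cons !big_nil /=.
  by have := pair_second_moment tau0 x y; rewrite -/(i x) -/(i y); lra.
have AQ : A * m <= Q * (1 - b).
  have := @Ex_pair_ge0 _ _ _ mu [:: (1, fun x => x * i x, fun=> 1);
    (-1, i, @posp R); (-1, @posp R, i); (1, fun=> 1, fun x => x * i x);
    (-1, fun x => x * i x, l); (-1, l, fun x => x * i x)].
  rewrite /= !big_cons !big_nil /= Ex_cst -/A -/Q -/m -/b => H.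
  suff : 0 <= 2 * (Q * (1 - b) - A * m) by lra.
  apply: le_trans (H _ _) _ => //; last by lra.
  move=> x y; rewrite !big_cons !big_nil /=.
  by have := pair_first_moment tau0 x y; rewrite -/(i x) -/(i y) -/(l x) -/(l y); lra.
have mb : m ^+ 2 <= X2 * b.
  rewrite /m -mean_parts; apply: Ex_cauchy => //; exact: pair_cauchy.
have mN : X2 ^+ 2 <= neg3 mu * m.
  by have := moment3 gn (@negp_ge0 R); rewrite mean_parts.
have mP : Y2 ^+ 2 <= pos3 mu * m by exact: moment3 gp (@posp_ge0 R).
have vE : variance2 mu = X2 + Y2 by exact: variance_parts.
(* [X2 * (X2 + Y2) <= 3 / 2 * X2 ^+ 2 + 1 / 2 * Y2 ^+ 2], then [mN] and [mP]: this is the origin of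
   the coefficients in [atom]. *)
have mc : X2 <= m * atom.
  by rewrite /atom mulrA ler_pdivlMr// vE; have := sqr_ge0 (X2 - Y2); lra.
have m_gt0 : 0 < m.
  rewrite lt_neqAle m0 andbT eq_sym; apply/eqP => m_eq0.
  move: mN mP; rewrite m_eq0 !mulr0 !real_exprn_even_le0 ?num_real//=.
  move=> /eqP X20 /eqP Y20.
  by move: var_gt0; rewrite vE X20 Y20 addr0 ltxx.
(* After multiplication by [m], the two terms are at most [X2 * Q * (1 - b)] and [X2 * Q * b], which
   add up to [X2 * Q <= m * atom * Q]. *)
have XA : X2 * A + m * Q <= atom * Q.
  rewrite -(ler_pM2l m_gt0).
  have := ler_wpM2l X0 AQ; have := ler_wpM2r Q0 mb; have := ler_wpM2r Q0 mc; lra.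
have : E (fun x => x ^+ 2 * i x) - tau * Q + atom * Q <= E (fun x => x * tail (x - tau)).
  have := @Ex_lin _ _ _ mu [:: (1, fun x => x ^+ 2 * i x); (atom - tau, fun x => x * i x)].
  rewrite /= !big_cons !big_nil /= => H.
  rewrite (_ : _ + _ = 1 * E (fun x : R => x ^+ 2 * i x) +
    ((atom - tau) * E (fun x : R => x * i x) + 0)); last by rewrite -/Q; ring.
  rewrite -H//; apply: Ex_le.
  - by have := @rint_lin _ _ _ mu [:: (1, fun x => x ^+ 2 * i x); (atom - tau, fun x => x * i x)]; apply.
  - exact: rint_tail.
  move=> x; rewrite !big_cons !big_nil /= mul1r addr0.
  by have := tail_ge_quadratic x tau0; rewrite -/(i x); lra.
rewrite -/T2 vE -/i -/A; lra.
Qed.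

(** Here the probability is simply bounded by 1, and the claim becomes [D <= atom * q0 + J]. The
    jump alone cannot cover the deficit [D], but [J] equals [D] to first order, and its error terms
    are multiples of [q0] thanks to [D ^+ 2 <= neg3 mu * q0]. *)
Let tail_neg t : 0 <= t ->
  variance2 mu * E (fun x => (0 < x - - t)%R%:R) <=
  E (fun x => x * tail (x - - t)).
Proof.
move=> t0.
pose i (x : R) : R := (0 < x - - t)%R%:R.
pose d (x : R) : R := negp x * posp (negp x - t).
pose q (x : R) : R := negp x * (1 - i x).
have gI : G 0 i := itau (- t).
have gd : G 2 d by exact: (growM gn (grow_max0 (growB gn (g1 t)))).
have gq : G 1 q by exact: (growM gn (growB (grow_cst _ 1) gI)).
have gJ : G 0 (fun x => jumpE (x - - t)).
  split; first by apply: measurableT_comp; [exact: measurable_jumpE|exact: measurable_funB].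
  exists (neg3 mu / variance2 mu / 2).
    by have /andP[] := jumpE_bounds 0; exact: le_trans.
  by move=> x; have /andP[j0 j1] := jumpE_bounds (x - - t); rewrite ger0_norm// expr0 mulr1.
have ii : I i by exact: (iI gI).
have id_ : I d by exact: (iI gd).
have iq : I q by exact: (iI gq).
have ixJ : I (fun x => x * jumpE (x - - t)) by exact: (iI (growM gi gJ)).
have qE x : q x = negp x * (t <= negp x)%R%:R.
  rewrite /q /i; have [[? ->]|[? ->]] := gt0_case (x - - t);
    have [[? ->]|[? ->]] := negp_case x; rewrite ?mul0r// ?subrr ?subr0 ?mulr0 ?mulr1.
    by rewrite (_ : (t <= - x) = false) ?mulr0//; apply/negbTE; rewrite -ltNge; lra.
  by rewrite (_ : t <= - x) ?mulr1//; lra.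
set D := E d; set q0 := E q; set J := E (fun x => x * jumpE (x - - t)).
have q_ge0 : 0 <= q0.
  apply: Ex_ge0 => x; rewrite mulr_ge0 ?negp_ge0//.
  by rewrite /i; case: (0 < _); rewrite ?subrr ?subr0.
have DN : D ^+ 2 <= neg3 mu * q0.
  apply: Ex_cauchy => // x y; rewrite !qE; apply: pair_jump => //; exact: negp_ge0.
(* [jump_tangent] with [n = negp y], averaged over [y] and then over [x]; the value [jumpE t] at the
   base point is multiplied by the mean of [x], which is 0. *)
have JD : variance2 mu * D - pos3 mu * q0 / 2 - D ^+ 2 <= variance2 mu * J.
  have JE r : variance2 mu * jumpE r = E (fun y => jump (negp y) r).
    by rewrite /jumpE mulrC divfK// gt_eqF.
  have := @Ex_lin_ge0 _ _ _ mu [:: (variance2 mu, fun x => x * jumpE (x - - t));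
    (- variance2 mu * jumpE t, fun x => x); (- D, fun x => x ^+ 2);
    (q0 / 2, fun x => posp x ^+ 3); (D, d)].
  rewrite /= !big_cons !big_nil /= mu0 -/J -/D -/(variance2 mu) -/(pos3 mu) => H.
  suff : 0 <= variance2 mu * J + (- variance2 mu * jumpE t * 0 +
   (- D * variance2 mu + (q0 / 2 * pos3 mu + (D * D + 0)))) by lra.
  apply: H => // x; rewrite !big_cons !big_nil /=.
  have := @Ex_lin_ge0 _ _ _ mu [:: (x, fun y => jump (negp y) (x - - t));
    (- x, fun y => jump (negp y) t); (- x ^+ 2 + d x, d);
    (posp x ^+ 3 / 2, q)].
  rewrite /= !big_cons !big_nil /= -/D -/q0 -!JE => {}H.
  suff : 0 <= x * (variance2 mu * jumpE (x - - t)) + (- x * (variance2 mu * jumpE t) +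
     ((- x ^+ 2 + d x) * D + (posp x ^+ 3 / 2 * q0 + 0))) by lra.
  apply: H => // y; rewrite !big_cons !big_nil /=.
  by have := jump_tangent x (negp_ge0 y) t0; rewrite -/(d y) -/(d x) -qE opprK; lra.
(* [x * posp (x + t)] is [x ^+ 2 + t * x - d x] and [x * i x] is [x + q x]; the linear terms have
   mean 0. *)
have tE : E (fun x => x * tail (x - - t)) = variance2 mu - D + atom * q0 + J.
  have := @Ex_lin _ _ _ mu [:: (1, fun x => x ^+ 2); (-1, d); (atom, q);
    (1, fun x => x * jumpE (x - - t)); (t + atom, fun x => x)].
  rewrite /= !big_cons !big_nil /= mu0 -/J -/D -/q0 -/(variance2 mu) => H.
  transitivity (1 * variance2 mu + (-1 * D + (atom * q0 + (1 * J + ((t + atom) * 0 + 0)))));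
    last by ring.
  rewrite -H//; congr Ex; apply/funext => x; rewrite !big_cons !big_nil /=.
  have dE : d x = x ^+ 2 + t * x - x * posp (x - - t).
    rewrite /d; have [[x0 ->]|[x0 ->]] := negp_case x.
      have -> : posp (x - - t) = x + t by rewrite opprK; apply/max_idPl; lra.
      by rewrite mul0r; ring.
    have [[? ->]|[? ->]] := posp_case (x - - t);
      have [[? ->]|[? ->]] := posp_case (- x - t); try by lra.
    have -> : x = - t by lra.
    by ring.
  have qxE : q x = - x + x * i x.
    rewrite /q /i; have [[? ->]|[? ->]] := gt0_case (x - - t);
      have [[? ->]|[? ->]] := negp_case x; lra.
  by rewrite dE qxE /tail -/(i x); ring.
have A1 : E i <= 1.
  rewrite -[leRHS](Ex_cst mu 1); apply: Ex_le => // x.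
  by rewrite /i; have [[? ->]|[? ->]] := gt0_case (x - - t).
have vA : variance2 mu * atom = 3 / 2 * neg3 mu + 1 / 2 * pos3 mu.
  by rewrite /atom mulrC divfK// gt_eqF.
rewrite tE -/i; have v0 := var_gt0.
have : D <= atom * q0 + J.
  by rewrite -(ler_pM2l v0) mulrDr mulrA vA; have := sqr_ge0 D; lra.
by have := ler_wpM2l (ltW v0) A1; lra.
Qed.

(** All real [tau] are needed: in [isum_tail] the threshold becomes [r - w], with [w] any value of
    the sum of the other variables. *)
Lemma law_tail tau :
  variance2 mu * E (fun x => (0 < x - tau)%R%:R) <= E (fun x => x * tail (x - tau)).
Proof.
have [t0|t0] := leP 0 tau; first exact: tail_pos.
by rewrite -(opprK tau); apply: tail_neg; lra.
Qed.

End law_tail.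

(** * Independence of one variable from the sum of the others *)

Section independence.
Context (d : measure_display) (T : measurableType d) (R : realType).
Variables (Q : probability T R) (n : nat) (X : 'I_n -> T -> R).
Hypothesis mX : forall i, measurable_fun setT (X i).
Hypothesis indX : mutually_independent_rv Q X.

Definition others (i : 'I_n) (t : T) : R := \sum_(j < n) (if j == i then 0 else X j t).

Lemma others_sum i t : others i t + X i t = \sum_(j < n) X j t.
Proof.
rewrite /others (bigD1 i)//= eqxx add0r [RHS](bigD1 i)//= [RHS]addrC; congr +%R.
by apply: eq_bigr => j /negbTE ->.
Qed.

Lemma measurable_others i : measurable_fun setT (others i).
Proof. by apply: measurable_sum => j; case: (j == i); [exact: measurable_cst|exact: mX]. Qed.

(** Cylinders that leave coordinate [i] free: a class stable under intersection, generating a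
    sigma-algebra for which [others i] is measurable. *)
Let cyl (i : 'I_n) : set (set T) := [set E | exists B : 'I_n -> set R,
  [/\ forall j, measurable (B j), B i = setT &
      E = \bigcap_(j in [set: 'I_n]) (X j @^-1` B j)]].

Let measurable_preX j B : measurable B -> measurable (X j @^-1` B).
Proof. by move=> mB; rewrite -[_ @^-1` _]setTI; exact: mX. Qed.

Let cyl_indep i A E : measurable A -> cyl i E ->
  Q (E `&` X i @^-1` A) = (Q (X i @^-1` A) * Q E)%E.
Proof.
move=> mA [B [mB Bi ->]].
pose B' j := if j == i then A else B j.
have mB' j : measurable (B' j) by rewrite /B'; case: ifP.
have -> : \bigcap_(j in [set: 'I_n]) (X j @^-1` B j) `&` X i @^-1` A =
    \bigcap_(j in [set: 'I_n]) (X j @^-1` B' j).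
  apply/seteqP; split=> [t [tB tA] j _|t tB].
    by rewrite /B'; case: eqVneq => [->//|_]; exact: tB.
  split; last by have := tB i Logic.I; rewrite /B' eqxx.
  move=> j _; have := tB j Logic.I; rewrite /B'; case: eqVneq => [->|_//].
  by rewrite Bi.
rewrite !indX// (bigD1 i)//= [in RHS](bigD1 i)//= /B' eqxx Bi preimage_setT.
rewrite probability_setT mul1e; congr (_ * _)%E.
by apply: eq_bigr => j /negbTE ->.
Qed.

(** As functions of the event on [others i], the two sides are finite measures: [Q] restricted to
    the event on [X i], and [Q] scaled by its probability. They agree on [cyl i] by mutual
    independence, hence on the sigma-algebra it generates. *)
Lemma others_indep i A B : measurable A -> measurable B ->
  Q (X i @^-1` A `&` others i @^-1` B) =
  (Q (X i @^-1` A) * Q (others i @^-1` B))%E.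
Proof.
move=> mA mB.
have mXA := measurable_preX i mA.
have QAfin : Q (X i @^-1` A) \is a fin_num by exact: fin_num_measure.
have QA0 : 0 <= fine (Q (X i @^-1` A)) by exact: fine_ge0.
pose m1 := mrestr Q mXA.
pose m2 := mscale (NngNum QA0) Q.
pose H := [set E | cyl i E /\ E `<=` setT].
have Hm : H `<=` measurable.
  move=> _ [[C [mC _ ->]] _]; apply: fin_bigcap_measurable => // j _.
  exact: measurable_preX.
have mV : <<s setT, H >> (others i @^-1` B).
  pose T' := g_sigma_algebraType H.
  have mY (j : 'I_n) : measurable_fun setT ((fun t => if j == i then 0 else X j t) : T' -> R).
    case: eqVneq => [_|ji]; first exact: measurable_cst.
    move=> _ C mC; rewrite setTI; apply: sub_gen_smallest; split=> //.
    exists (fun k => if k == j then C else setT); split.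
    - by move=> k; case: ifP.
    - by rewrite eq_sym (negbTE ji).
    - apply/seteqP; split=> [t tC k _|t tC].
        by case: eqVneq => [->|_].
      by have := tC j Logic.I; rewrite eqxx.
  have mV : measurable_fun setT (others i : T' -> R) by exact: measurable_sum.
  by have := mV measurableT _ mB; rewrite setTI.
have := @g_sigma_algebra_measure_unique_trace _ R T (cyl i) setT measurableT Hm _ m1 m2.
rewrite setIC => H1.
have -> : (Q (X i @^-1` A) * Q (others i @^-1` B))%E = m2 (others i @^-1` B).
  by rewrite /m2/= /mscale/= fineK.
have -> : Q (others i @^-1` B `&` X i @^-1` A) = m1 (others i @^-1` B) by [].
apply: H1 => //.
- move=> _ _ [[C [mC Ci ->]] _] [[C' [mC' Ci' ->]] _]; split=> //.
  exists (fun j => C j `&` C' j); split; first by move=> j; exact: measurableI.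
    by rewrite Ci Ci' setTI.
  apply/seteqP; split=> [t [tC tC'] j _|t tC]; first by split; [exact: tC|exact: tC'].
  by split=> j _; have [] := tC j Logic.I.
- rewrite /m1 /m2/= /mrestr /mscale/= setTI fineK//.
  by rewrite probability_setT mule1.
- by move=> E [cE _]; rewrite /m1 /m2/= /mrestr /mscale/= fineK// cyl_indep.
- by rewrite /m1/= /mrestr setTI ltey_eq QAfin.
Qed.

(* Fubini for the pair (X i, sum of the others), whose law is a product. *)
Lemma indep_expectation_ge0 (mu : probability R R) i (f : R -> R -> R) :
  (forall B, measurable B -> Q (X i @^-1` B) = mu B) ->
  measurable_fun setT (fun z : R * R => f z.1 z.2) ->
  rint Q (fun t => f (X i t) (others i t)) ->
  (forall v, rint mu (fun w => f w v)) ->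
  (forall v, 0 <= Ex mu (fun w => f w v)) ->
  0 <= Ex Q (fun t => f (X i t) (others i t)).
Proof.
move=> muX mf iF if_ f0.
pose F (z : R * R) := (f z.1 z.2)%:E.
have mF : measurable_fun setT F by exact/measurable_EFinP.
pose V : {mfun T >-> R} :=
  HB.pack (others i) (isMeasurableFun.Build _ _ _ _ _ (measurable_others i)).
pose nu : probability R R := distribution Q V.
have mphi : measurable_fun setT (fun t => (X i t, others i t)).
  by apply: measurable_fun_pair => //; exact: measurable_others.
pose phi : {mfun T >-> (R * R)%type} :=
  HB.pack (fun t => (X i t, others i t)) (isMeasurableFun.Build _ _ _ _ _ mphi).
pose m' : probability (R * R)%type R := distribution Q phi.
have mE A : measurable A -> (mu \x nu)%E A = m' A.
  apply: product_measure_unique => B C mB mC.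
  transitivity (Q (X i @^-1` B) * Q (others i @^-1` C))%E; last by rewrite muX.
  by rewrite -others_indep.
have iF' : (mu \x nu)%E.-integrable setT F.
  have /integrableP[_ m'F] : m'.-integrable setT F.
    by apply: integrable_pushforward => //; rewrite preimage_setT.
  apply/integrableP; split=> //; apply: le_lt_trans m'F.
  by rewrite (eq_measure_integral m')// => A mA _; exact: mE.
rewrite /Ex /Rintegral fine_ge0//.
have -> : (\int[Q]_t (f (X i t) (others i t))%:E)%E = (\int[m']_z F z)%E.
  by rewrite integral_distribution.
rewrite (eq_measure_integral (mu \x nu)%E); last by move=> A mA _; exact/esym/mE.
rewrite -integral21_prod_meas1//; apply: integral_ge0 => v _.
rewrite /fubini_G /F/= -[X in (0 <= X)%E]fineK; first by rewrite lee_fin; exact: f0.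
exact: integrable_fin_num (if_ v).
Qed.

End independence.

(** * Calculus on the half line, even extension and rescaling *)

Section half_line.
Context (R : realType).
Implicit Types (f df h k : R -> R) (x y z b L : R).

(** Differentiability is asked only at positive points because the Gaussian primitive starts at 0;
    one-sided continuity takes care of the endpoint. *)
Lemma half_line_MVT f df x y :
  (forall z, 0 < z -> is_derive z 1 f (df z)) ->
  (forall z, 0 <= z -> {within `[0, z], continuous f}) ->
  0 <= x -> x <= y -> exists2 c, x <= c <= y & f y - f x = df c * (y - x).
Proof.
move=> dfE cf x0 xy.
have [||c cxy E] := @MVT_segment R f df x y xy.
- by move=> z; rewrite in_itv/= => /andP[xz _]; apply: dfE; exact: le_lt_trans xz.
- apply: continuous_subspaceW (cf y (le_trans x0 xy)).
  by apply: subset_itvr; rewrite bnd_simp.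
by exists c => //; move: cxy; rewrite in_itv.
Qed.

Lemma pos_nincr f df :
  (forall z, 0 < z -> is_derive z 1 f (df z)) ->
  (forall z, 0 < z -> df z <= 0) ->
  forall x y, 0 < x -> x <= y -> f y <= f x.
Proof.
move=> dfE df0 x y x0 xy.
have [||c cxy E] := @MVT_segment R f df x y xy.
- by move=> z; rewrite in_itv/= => /andP[xz _]; apply: dfE; exact: lt_trans xz.
- apply: derivable_within_continuous => z; rewrite in_itv/= => /andP[xz _].
  by have [] := dfE z (lt_le_trans x0 xz).
move: cxy; rewrite in_itv/= => /andP[xc _].
by rewrite -subr_le0 E mulr_le0_ge0 ?subr_ge0//; apply/df0/(lt_le_trans x0).
Qed.

Lemma half_line_tangent h k :
  (forall z, 0 < z -> is_derive z 1 h (k z)) ->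
  (forall z, 0 <= z -> {within `[0, z], continuous h}) ->
  (forall x y, 0 <= x -> x <= y -> k x <= k y) ->
  forall x y, 0 <= x -> 0 <= y -> h x - h y <= k x * (x - y).
Proof.
move=> dh ch kle x y x0 y0; have [xy|/ltW yx] := leP x y.
  have [c /andP[xc cy] E] := half_line_MVT dh ch x0 xy.
  have := kle _ _ x0 xc => /(ler_wpM2r (_ : 0 <= y - x)); rewrite subr_ge0 => /(_ xy).
  by lra.
have [c /andP[yc cx] E] := half_line_MVT dh ch y0 yx.
rewrite E ler_wpM2r ?subr_ge0// kle//; exact: le_trans yc.
Qed.

Lemma even_c1_convex h k L :
  k 0 = 0 ->
  (forall x, k (- x) = - k x) ->
  (forall x y, 0 <= x -> x <= y -> k x <= k y) ->
  (forall x y, 0 <= x -> x <= y -> k y - k x <= L * (y - x)) ->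
  (forall x y, 0 <= x -> 0 <= y -> h x - h y <= k x * (x - y)) ->
  (forall x y, 0 <= x -> 0 <= y -> h y - h x <= k x * (y - x) + L / 2 * (y - x) ^+ 2) ->
  c1_convex (fun x => h `|x|) k L.
Proof.
move=> k0 kN kle klip ktan ktay.
have kge0 x : 0 <= x -> 0 <= k x by move=> x0; rewrite -k0 kle.
have kub x : 0 <= x -> k x <= L * x.
  by move=> x0; have := klip _ _ (lexx 0) x0; rewrite k0 !subr0.
have kneg x : k x = - k (- x) by rewrite kN opprK.
split=> [x y xy|x y xy|x y xy|x y].
- have [x0|x0] := leP 0 x; first exact: kle.
  have [y0|y0] := leP 0 y.
    rewrite kneg; apply: (@le_trans _ _ 0); last exact: kge0.
    by rewrite oppr_le0 kge0//; lra.
  by rewrite (kneg x) (kneg y) lerN2 kle//; lra.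
- have [x0|x0] := leP 0 x; first exact: klip.
  have [y0|y0] := leP 0 y.
    rewrite (kneg x).
    by have := kub y y0; have := kub (- x); rewrite oppr_ge0 => /(_ (ltW x0)); lra.
  rewrite (kneg x) (kneg y).
  by have := klip (- y) (- x); rewrite oppr_ge0 lerN2 => /(_ (ltW y0) xy); lra.
- have [x0|x0] := leP 0 x.
    by have y0 := le_trans x0 xy; rewrite !ger0_norm//; exact: ktay.
  have x0' : 0 <= - x by lra.
  rewrite (ltr0_norm x0) (kneg x).
  have [y0|y0] := leP 0 y.
    rewrite (ger0_norm y0).
    have := ktay _ _ (lexx 0) y0; have := ktay _ _ x0' (lexx 0).
    by rewrite k0 mul0r add0r; have := kub _ x0' => /(ler_wpM2r y0); lra.
  rewrite (ltr0_norm y0); have y0' : 0 <= - y by lra.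
  by have := ktay _ _ x0' y0'; lra.
- have [x0|x0] := leP 0 x.
    rewrite (ger0_norm x0); have [y0|y0] := leP 0 y.
      by rewrite (ger0_norm y0) ktan.
    rewrite (ltr0_norm y0); have y0' : 0 <= - y by lra.
    have := ktan _ _ x0 y0'; have : 0 <= k x * - y by rewrite mulr_ge0// kge0.
    by lra.
  have x0' : 0 <= - x by lra.
  rewrite (ltr0_norm x0) (kneg x); have [y0|y0] := leP 0 y.
    rewrite (ger0_norm y0).
    have := ktan _ _ x0' y0; have : 0 <= k (- x) * y by rewrite mulr_ge0// kge0.
    by lra.
  rewrite (ltr0_norm y0); have y0' : 0 <= - y by lra.
  by have := ktan _ _ x0' y0'; lra.
Qed.

Lemma c1_convex_scale h k L b : 0 < b -> c1_convex h k L ->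
  c1_convex (fun x => b * h (x / b)) (fun x => k (x / b)) (L / b).
Proof.
move=> b0 hk; have bN0 : b != 0 by rewrite gt_eqF.
have dE x y : y - x = b * (y / b - x / b).
  by rewrite mulrBr ![b * _]mulrC !divfK.
have mono x y : x <= y -> x / b <= y / b by rewrite ler_pM2r// invr_gt0.
have LE z : L / b * (b * z) = L * z by rewrite mulrA divfK.
split=> [x y xy|x y xy|x y xy|x y].
- exact/(c1_le hk)/mono.
- by rewrite (dE x y) LE; exact/(c1_lip hk)/mono.
- rewrite -mulrBr (dE x y); have := c1_taylor hk (mono _ _ xy).
  move=> /(ler_wpM2l (ltW b0)) /le_trans; apply.
  have -> : L / b / 2 * (b * (y / b - x / b)) ^+ 2 = L / 2 * b * (y / b - x / b) ^+ 2.
    rewrite exprMn [b ^+ 2]expr2.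
    by transitivity (L / b * b * b / 2 * (y / b - x / b) ^+ 2);
      [ring|rewrite divfK//; ring].
  by lra.
- rewrite -mulrBr (dE y x) mulrCA ler_pM2l//; exact: (c1_tangent hk).
Qed.

End half_line.

(** * The Mills ratio and the Stein solution *)

Section mills.
Context (R : realType).
Import gauss_integral_proof.
Implicit Types x y z : R.

Local Notation J := (@integral0_gauss R).
Local Notation g := (@gauss_fun R).
Definition gauss_mass : R := Num.sqrt pi / 2.
Local Notation A := gauss_mass.

Let cvg_J : J x @[x --> +oo] --> A.
Proof.
have : Num.sqrt (J x ^+ 2) @[x --> +oo] --> Num.sqrt (pi / 4 : R).
  by apply: continuous_cvg => //; [exact: sqrt_continuous|exact: cvg_integral0_gauss_sqr].
rewrite sqrtrM ?pi_ge0// sqrtrV// (_ : 4 = 2 ^+ 2); last by rewrite expr2 -natrM.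
rewrite sqrtr_sqr ger0_norm// (_ : (fun _ => Num.sqrt _) = J)//.
by apply/funext => r; rewrite sqrtr_sqr ger0_norm// integral0_gauss_ge0.
Qed.

Let integrable_gauss (a b : R) :
  lebesgue_measure.-integrable `[a, b] (EFin \o g).
Proof.
apply: continuous_compact_integrable => //; first exact: segment_compact.
by apply: continuous_subspaceT; exact: continuous_gauss_fun.
Qed.

Let derive_J x : 0 < x -> is_derive x 1 J (g x).
Proof.
move=> x0; have [||||dJ JE] := @continuous_FTC1_closed R g 0 x (x + 1).
- by rewrite ltrDl.
- exact: integrable_gauss.
- exact: x0.
- exact: continuous_gauss_fun.
apply: DeriveDef; [exact: dJ|rewrite -derive1E; exact: JE].
Qed.

Let continuous_J x : 0 <= x -> {within `[0, x], continuous J}.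
Proof.
by move=> x0; apply: parameterized_integral_continuous => //; exact: integrable_gauss.
Qed.

(** [A] is the integral of exp(-t^2) over the half line, so this is the Mills ratio of the normal
    law of variance 1/2. Other variances are reached by rescaling. *)
Definition mills x := expR (x ^+ 2) * (A - J x).

Let J0 : J 0 = 0.
Proof. by rewrite /integral0_gauss set_itv1 Rintegral_set1. Qed.

Let mills0 : mills 0 = A.
Proof. by rewrite /mills J0 expr0n/= expR0 mul1r subr0. Qed.

Let gaussV x : expR (x ^+ 2) * g x = 1.
Proof. by rewrite /gauss_fun -expRD subrr expR0. Qed.

Let dM (f h : R -> R) x a b : is_derive x 1 f a -> is_derive x 1 h b ->
  is_derive x 1 (fun z => f z * h z) (f x * b + h x * a).
Proof. by move=> df dh; exact: is_deriveM. Qed.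

Let dB (f h : R -> R) x a b : is_derive x 1 f a -> is_derive x 1 h b ->
  is_derive x 1 (fun z => f z - h z) (a - b).
Proof. by move=> df dh; exact: is_deriveB. Qed.

Let dD (f h : R -> R) x a b : is_derive x 1 f a -> is_derive x 1 h b ->
  is_derive x 1 (fun z => f z + h z) (a + b).
Proof. by move=> df dh; exact: is_deriveD. Qed.

Let dC x (c : R) : is_derive x 1 (fun=> c) 0.
Proof. exact: is_derive_cst. Qed.

Let did x : is_derive x 1 (fun z => z) 1.
Proof. exact: is_derive_id. Qed.

Let dV (f : R -> R) x a : f x != 0 -> is_derive x 1 f a ->
  is_derive x 1 (fun z => (f z)^-1) (- (f x) ^- 2 * a).
Proof. by move=> fx0 df; have := is_deriveV fx0 df. Qed.

Let dX2 x : is_derive x 1 (fun z => z ^+ 2) (2 * x).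
Proof. by apply: (is_derive_eq (dM (did x) (did x))); ring. Qed.

Let dexp (f : R -> R) x a : is_derive x 1 f a ->
  is_derive x 1 (fun z => expR (f z)) (expR (f x) * a).
Proof. by move=> df; apply: is_derive1_comp; exact: is_derive_expR. Qed.

Let derive_gauss x : is_derive x 1 g (- (2 * x) * g x).
Proof.
have dN : is_derive x 1 (fun z => - z ^+ 2) (- (2 * x)) by exact: is_deriveN.
by apply: (is_derive_eq (dexp dN)); rewrite mulrC.
Qed.

Let derive_mills x : 0 < x -> is_derive x 1 mills (2 * x * mills x - 1).
Proof.
move=> x0; apply: (is_derive_eq (dM (dexp (dX2 x)) (dB (dC x A) (derive_J x0)))).
by rewrite -(gaussV x) /mills; ring.
Qed.

Let tailJ_le (c x : R) : (forall y, x <= y -> J y - A <= c) -> 0 <= c.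
Proof.
move=> Jc; have cvg0 : J y - A @[y --> +oo] --> 0.
  by rewrite -(subrr A); apply: cvgB => //; exact: cvg_cst.
apply: (cvgr_to_le cvg0); near=> y; apply: Jc; near: y; apply: nbhs_pinfty_ge; exact: num_real.
Unshelve. all: end_near. Qed.

Let mills_ub x : 0 < x -> 2 * x * mills x <= 1.
Proof.
move=> x0.
(* [D] has nonpositive derivative on the positive half line, and the part [J - A] of it tends to 0
   while the rest is nonnegative; hence [D x >= 0]. [mills_lb] rests on the same argument. *)
pose D z := g z * (2 * z)^-1 - (A - J z).
have dD_ z : 0 < z -> is_derive z 1 D (- (g z * (2 * z ^+ 2)^-1)).
  move=> z0; have z0' : z != 0 by rewrite gt_eqF.
  have z2 : 2 * z != 0 by rewrite mulf_neq0.
  apply: (is_derive_eq (dB (dM (derive_gauss z) (dV z2 (dM (dC z 2) (did z))))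
    (dB (dC z A) (derive_J z0)))).
  by field.
have D0 : 0 <= D x.
  apply: (@tailJ_le _ x) => y xy; have y0 := lt_le_trans x0 xy.
  have : D y <= D x.
    apply: (pos_nincr dD_) => // z z0.
    by rewrite oppr_le0 mulr_ge0 ?gauss_fun_ge0// invr_ge0 mulr_ge0// sqr_ge0.
  have : 0 <= g y * (2 * y)^-1.
    by rewrite mulr_ge0 ?gauss_fun_ge0// invr_ge0 mulr_ge0// ltW.
  by rewrite /D; lra.
have : 0 <= expR (x ^+ 2) * (2 * x) * D x by rewrite !mulr_ge0 ?expR_ge0// ltW.
have -> : expR (x ^+ 2) * (2 * x) * D x = expR (x ^+ 2) * g x - 2 * x * mills x.
  by rewrite /D /mills; field; rewrite gt_eqF.
by rewrite gaussV; lra.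
Qed.

(** Equivalent to a nonnegative derivative of [2 * x * mills x], that is, to the monotonicity of the
    derivative of the Stein solution. *)
Let mills_lb x : 0 < x -> x <= (1 + 2 * x ^+ 2) * mills x.
Proof.
move=> x0.
have q0 z : 0 < 1 + 2 * z ^+ 2 by have := sqr_ge0 z; lra.
have qN0 z : 1 + 2 * z ^+ 2 != 0 by rewrite gt_eqF.
pose D z := (A - J z) - g z * (z * (1 + 2 * z ^+ 2)^-1).
have dD_ z : 0 < z -> is_derive z 1 D (- (2 * g z * (1 + 2 * z ^+ 2) ^- 2)).
  move=> z0.
  apply: (is_derive_eq (dB (dB (dC z A) (derive_J z0)) (dM (derive_gauss z)
    (dM (did z) (@dV (fun z => 1 + 2 * z ^+ 2) z _ (qN0 z) (dD (dC z 1) (dM (dC z 2) (dX2 z)))))))).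
  by field.
have D0 : 0 <= D x.
  have cvg0 : A - J y - g y @[y --> +oo] --> A - A - 0.
    by apply: cvgB; [apply: cvgB => //; exact: cvg_cst|exact: cvg_gauss_fun].
  rewrite subrr subr0 in cvg0.
  apply: (cvgr_to_le cvg0); near=> y.
  have xy : x <= y by near: y; apply: nbhs_pinfty_ge; exact: num_real.
  have y0 := lt_le_trans x0 xy.
  have : D y <= D x.
    apply: (pos_nincr dD_) => // z z0.
    by rewrite oppr_le0 mulr_ge0 ?mulr_ge0 ?gauss_fun_ge0// invr_ge0 exprn_ge0 ?ltW.
  have : g y * (y * (1 + 2 * y ^+ 2)^-1) <= g y * 1.
    rewrite ler_wpM2l ?gauss_fun_ge0// ler_pdivrMr//.
    by have := sqr_ge0 (y - 1); have := sqr_ge0 y; lra.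
  by rewrite /D; lra.
have : 0 <= expR (x ^+ 2) * (1 + 2 * x ^+ 2) * D x.
  by rewrite !mulr_ge0 ?expR_ge0// ltW.
have -> : expR (x ^+ 2) * (1 + 2 * x ^+ 2) * D x =
    (1 + 2 * x ^+ 2) * mills x - expR (x ^+ 2) * g x * x.
  by rewrite /D /mills; field.
by rewrite gaussV; lra.
Unshelve. all: end_near. Qed.

Let A_gt0 : 0 < A.
Proof. by rewrite divr_gt0// sqrtr_gt0 pi_gt0. Qed.

Let mills_ub0 x : 0 <= x -> 2 * x * mills x <= 1.
Proof.
by rewrite le_eqVlt => /predU1P[<-|/mills_ub//]; rewrite mulr0 mul0r.
Qed.

Let mills_lb0 x : 0 <= x -> x <= (1 + 2 * x ^+ 2) * mills x.
Proof.
rewrite le_eqVlt => /predU1P[<-|/mills_lb//].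
by rewrite expr0n/= mulr0 addr0 mul1r mills0 ltW.
Qed.

Let continuous_expsqr : continuous (fun x => expR (x ^+ 2)).
Proof.
by move=> x; apply: continuous_comp; [exact: exprn_continuous|exact: continuous_expR].
Qed.

Let continuous_mills x : 0 <= x -> {within `[0, x], continuous mills}.
Proof.
move=> x0 z; apply: cvgM; first exact: continuous_subspaceT continuous_expsqr z.
by apply: cvgB; [exact: cvg_cst|exact: continuous_J].
Qed.

Let mills_le x : 0 <= x -> mills x <= A.
Proof.
move=> x0.
have [c /andP[c0 cx] E] := half_line_MVT derive_mills continuous_mills (lexx 0) x0.
rewrite -mills0 -subr_le0 E mulr_le0_ge0 ?subr0// subr_le0; exact: mills_ub0.
Qed.

Let mills_nincr x y : 0 <= x -> x <= y -> mills y <= mills x.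
Proof.
move=> x0 xy.
have [c /andP[xc _] E] := half_line_MVT derive_mills continuous_mills x0 xy.
rewrite -subr_le0 E mulr_le0_ge0 ?subr_ge0// subr_le0.
exact/mills_ub0/(le_trans x0).
Qed.

Let k x := 2 * x * mills `|x|.
Let kh x := 2 * x * mills x.
Let dkh x := 2 * ((1 + 2 * x ^+ 2) * mills x - x).

Let kE x : 0 <= x -> k x = kh x.
Proof. by move=> x0; rewrite /k /kh ger0_norm. Qed.

Let derive_kh x : 0 < x -> is_derive x 1 kh (dkh x).
Proof.
move=> x0; apply: (is_derive_eq (dM (dM (dC x 2) (did x)) (derive_mills x0))).
by rewrite /dkh; ring.
Qed.

Let continuous_kh x : 0 <= x -> {within `[0, x], continuous kh}.
Proof.
move=> x0 z; apply: cvgM; last exact: continuous_mills.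
have c2 : continuous (fun x : R => 2 * x).
  by move=> w; apply: cvgM; [exact: cvg_cst|exact: cvg_id].
exact: continuous_subspaceT c2 z.
Qed.

(** For the upper bound two estimates of [mills] are combined: [mills x <= A] when [2 * x * A <= 1],
    and [mills x <= 1 / (2 * x)] beyond. Both keep [dkh x] below its value [2 * A] at 0. *)
Let dkh_bounds x : 0 <= x -> 0 <= dkh x <= 2 * A.
Proof.
move=> x0; apply/andP; split; first by have := mills_lb0 x0; rewrite /dkh; lra.
rewrite /dkh ler_pM2l//; have A0 := A_gt0; have mA := mills_le x0; have mu := mills_ub0 x0.
have [xA|xA] := leP (2 * x * A) 1.
  have : (1 + 2 * x ^+ 2) * mills x <= (1 + 2 * x ^+ 2) * A.
    by rewrite ler_wpM2l// addr_ge0// mulr_ge0// sqr_ge0.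
  have : x * (2 * x * A) <= x * 1 by rewrite ler_wpM2l.
  by lra.
have x_gt0 : 0 < x.
  by rewrite lt_neqAle x0 andbT; apply/eqP => x_0; move: xA; rewrite -x_0; lra.
rewrite -(ler_pM2l (_ : 0 < 2 * x)); last by rewrite mulr_gt0.
have : (1 + 2 * x ^+ 2) * (2 * x * mills x) <= (1 + 2 * x ^+ 2) * 1.
  by rewrite ler_wpM2l// addr_ge0// mulr_ge0// sqr_ge0.
by lra.
Qed.

Let k_le x y : 0 <= x -> x <= y -> k x <= k y.
Proof.
move=> x0 xy; have y0 := le_trans x0 xy.
have [c /andP[xc _] E] := half_line_MVT derive_kh continuous_kh x0 xy.
have /andP[d0 _] := dkh_bounds (le_trans x0 xc).
by rewrite !kE// -subr_ge0 E mulr_ge0// subr_ge0.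
Qed.

Let k_lip x y : 0 <= x -> x <= y -> k y - k x <= 2 * A * (y - x).
Proof.
move=> x0 xy; have y0 := le_trans x0 xy.
have [c /andP[xc _] E] := half_line_MVT derive_kh continuous_kh x0 xy.
have /andP[_ d0] := dkh_bounds (le_trans x0 xc).
by rewrite !kE// E ler_wpM2r// subr_ge0.
Qed.

(** Since [k x / 2] is [x * mills |x|], the even extension satisfies
    [x * h |x| - k x / 2 = x * |x|]. The summand [x] also cancels the [-1] in the derivative of
    [mills], so that [h] has derivative [k]. *)
Let h x := x + mills x.

Let derive_h x : 0 < x -> is_derive x 1 h (k x).
Proof.
move=> x0; apply: (is_derive_eq (dD (did x) (derive_mills x0))).
by rewrite kE ?ltW// /kh; ring.
Qed.

Let continuous_h x : 0 <= x -> {within `[0, x], continuous h}.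
Proof.
move=> x0 z; apply: cvgD; last exact: continuous_mills.
have ci : continuous (fun x : R => x) by move=> w; exact: cvg_id.
exact: continuous_subspaceT ci z.
Qed.

Let h_tangent := half_line_tangent derive_h continuous_h k_le.

(** The tangent inequality for [A * z ^+ 2 - h z], which is convex because [k] is
    [2 * A]-Lipschitz. *)
Let h_taylor x y : 0 <= x -> 0 <= y ->
  h y - h x <= k x * (y - x) + 2 * A / 2 * (y - x) ^+ 2.
Proof.
move=> x0 y0.
have dh2 z : 0 < z -> is_derive z 1 (fun z => A * z ^+ 2 - h z) (2 * A * z - k z).
  move=> z0; apply: (is_derive_eq (dB (dM (dC z A) (dX2 z)) (derive_h z0))).
  by ring.
have ch2 z : 0 <= z -> {within `[0, z], continuous (fun z => A * z ^+ 2 - h z)}.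
  move=> z0 w; apply: cvgB; last exact: continuous_h.
  have cA : continuous (fun x : R => A * x ^+ 2).
    by move=> v; apply: cvgM; [exact: cvg_cst|exact: exprn_continuous].
  exact: continuous_subspaceT cA w.
have k2 u v : 0 <= u -> u <= v -> 2 * A * u - k u <= 2 * A * v - k v.
  by move=> u0 uv; have := k_lip u0 uv; lra.
have := half_line_tangent dh2 ch2 k2 x0 y0; lra.
Qed.

Let hk_convex : c1_convex (fun x => h `|x|) k (2 * A).
Proof.
apply: even_c1_convex => //.
- by rewrite /k mulr0 mul0r.
- by move=> x; rewrite /k normrN; ring.
Qed.

Let measurable_h : measurable_fun setT (fun x => h `|x|).
Proof.
apply: measurable_funD; first exact: normr_measurable.
have mm : measurable_fun setT (fun x => - mills (posp x)).
  apply: nondecreasing_measurable => // x y xy.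
  rewrite lerN2; apply: mills_nincr; first exact: posp_ge0.
  by rewrite /posp ge_max !le_max xy lexx orbT.
rewrite (_ : (fun x => _) = (fun x => - - mills (posp `|x|))).
  by apply: measurableT_comp => //; apply: (measurableT_comp mm); exact: normr_measurable.
by apply/funext => x; rewrite opprK /posp (max_idPl _).
Qed.

(* The Stein equation for [x * |x|] under the centered normal law of variance
   [s]: the solution is [|x|] plus a rescaled Mills ratio. *)
Lemma stein_solution (s : R) : 0 < s -> exists K k' L, [/\
  measurable_fun setT K, measurable_fun setT k', c1_convex K k' L,
  forall x, x * K x - s * k' x = x * `|x| & L ^+ 2 * s <= 2].
Proof.
move=> s0; pose b := Num.sqrt (2 * s).
have b0 : 0 < b by rewrite sqrtr_gt0 mulr_gt0.
have b2 : b ^+ 2 = 2 * s by rewrite sqr_sqrtr// mulr_ge0// ltW.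
have bN0 : b != 0 by rewrite gt_eqF.
have hk := c1_convex_scale b0 hk_convex.
exists (fun x => b * h `|x / b|), (fun x => k (x / b)), (2 * A / b); split.
- apply: measurable_funM => //; apply: (measurableT_comp measurable_h).
  exact: measurable_funM.
- by apply: nondecreasing_measurable => // x y; exact: c1_le hk _ _.
- exact: hk.
- move=> x; have -> : s = b ^+ 2 / 2 by rewrite b2; field.
  have xE : `|x| = b * `|x / b|.
    by rewrite normrM normfV (gtr0_norm b0) mulrC divfK.
  by rewrite xE /h /k; field.
(* The exact value is pi / 2. *)
- have -> : (2 * A / b) ^+ 2 * s = (2 * A) ^+ 2 / 2.
    have -> : s = b ^+ 2 / 2 by rewrite b2; field.
    by field.
  have -> : 2 * A = Num.sqrt pi by rewrite /gauss_mass; field.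
  rewrite sqr_sqrtr ?pi_ge0//.
  by have := @pihalf_lt2 R; lra.
Qed.

End mills.

Lemma grow_shift (R : realType) (j : nat) (f : R -> R) (v : R) :
  grow (fun x : R => 1 + `|x|) j f ->
  grow (fun x : R => 1 + `|x|) j (fun x => f (v + x)).
Proof.
move=> [mf [a a0 fa]]; split.
  by apply: measurableT_comp => //; exact: measurable_funD.
exists (a * (1 + `|v|) ^+ j); first by rewrite mulr_ge0// exprn_ge0// addr_ge0.
move=> x; rewrite (le_trans (fa _))// -mulrA ler_wpM2l// -exprMn.
rewrite lerXn2r ?nnegrE ?mulr_ge0 ?addr_ge0//.
have := ler_normD v x; have := normr_ge0 v; have := normr_ge0 x.
by move=> x0 v0; have := mulr_ge0 x0 v0; lra.
Qed.

(** To be read with [p] the probability of S > 2M, [a], [e2], [e3] the first three moments of S_+,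
    [s ^+ 2] the variance of S, [m] the ratio [pos3 mu / variance2 mu], and [l] the Lipschitz
    constant of the Stein solution times [s ^+ 2]. *)
Lemma median_numerics (R : realType) (s M m l a p e2 e3 : R) :
  0 < s -> 0 <= m -> m <= M -> 0 <= l -> l ^+ 2 <= 2 * s ^+ 2 -> p <= 1 ->
  s ^+ 2 * p <= e2 - 3 / 2 * m * a + 9 / 16 * m ^+ 2 * (1 - p) ->
  s ^+ 2 * p <= e2 - 3 * m * M * p ->
  e2 <= 1 / 2 * s ^+ 2 + 1 / 4 * l * m ->
  e3 <= 2 * s ^+ 2 * a + s ^+ 2 * m ->
  (forall c, 0 < c -> 4 * c * e2 <= e3 + 4 * c ^+ 2 * a) ->
  p <= 1 / 2.
Proof.
move=> s0 m0 mM l0 ls p1 I II e2le III IV; rewrite leNgt; apply/negP => p2.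
have s20 : 0 < s ^+ 2 by rewrite exprn_gt0.
have sp : 1 / 2 * s ^+ 2 < s ^+ 2 * p by rewrite mulrC ltr_pM2l.
have M0 : 0 <= M := le_trans m0 mM.
have mMp : m * M * (1 / 2) <= m * M * p by rewrite ler_wpM2l ?mulr_ge0// ltW.
have m_gt0 : 0 < m.
  rewrite lt_neqAle m0 andbT; apply/eqP => m_eq0.
  by move: mMp II e2le; rewrite -m_eq0 !(mulr0, mul0r); lra.
(* [17 / 12] is a rational upper bound for the square root of 2. *)
have lub : l <= 17 / 12 * s.
  rewrite -(ler_pXn2r (ltn0Sn 1)) ?nnegrE//; last by rewrite mulr_ge0// ltW.
  by apply: (le_trans ls); lra.
(* [II], the bound on [e2] and [1 / 2 < p] leave [3 * m * M * p < l * m / 4]. *)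
have Ml : M < 1 / 6 * l.
  have : m * (3 / 2 * M) < m * (1 / 4 * l) by lra.
  by rewrite ltr_pM2l//; lra.
have al : 3 / 2 * a < 1 / 4 * l + 9 / 32 * m.
  have mp : m ^+ 2 * (1 - p) <= m ^+ 2 * (1 / 2) by rewrite ler_wpM2l ?sqr_ge0//; lra.
  have : m * (3 / 2 * a) < m * (1 / 4 * l + 9 / 32 * m) by lra.
  by rewrite ltr_pM2l.
have as_ : a < 2 / 7 * s by lra.
have c0 : 0 < 7 / 10 * s by rewrite mulr_gt0.
have e2lb : 1 / 2 * s ^+ 2 <= e2 by have := mulr_ge0 (mulr_ge0 m0 M0) (ltW (lt_trans _ p2)); lra.
(* [IV] at [c = 7 / 10 * s], where [99 / 25 = 2 + 4 * (7 / 10) ^+ 2]. As [a < 2 / 7 * s] and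
   [m < 17 / 72 * s], the right factor stays below [1.37 * s], a contradiction. *)
have : s ^+ 2 * (7 / 5 * s) <= s ^+ 2 * (99 / 25 * a + m).
  have := IV _ c0; have := ler_wpM2l (ltW c0) e2lb; lra.
by rewrite ler_pM2l//; lra.
Qed.

Lemma posp_c1_convex (R : realType) : c1_convex (fun x : R => posp x ^+ 2 / 2) (@posp R) 1.
Proof.
split=> [x y xy|x y xy|x y xy|x y].
- by have [[? ->]|[? ->]] := posp_case x; have [[? ->]|[? ->]] := posp_case y; lra.
- by have [[? ->]|[? ->]] := posp_case x; have [[? ->]|[? ->]] := posp_case y; lra.
- have [[? ->]|[? ->]] := posp_case x; have [[? ->]|[? ->]] := posp_case y.
  + by lra.
  + by have := sqr_ge0 (y - x); lra.
  + have : 0 <= (- x) * (2 * y - x) by rewrite mulr_ge0; lra.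
    by lra.
  + by have := sqr_ge0 (y - x); lra.
- have [[? ->]|[? ->]] := posp_case x; have [[? ->]|[? ->]] := posp_case y.
  + by have := sqr_ge0 (y - x); lra.
  + have : 0 <= x * - y by rewrite mulr_ge0; lra.
    by have := sqr_ge0 x; lra.
  + by have := sqr_ge0 y; lra.
  + by lra.
Qed.

(** * From one summand to the sum, and the bound on the median *)

Section iid_sum.
Context (d : measure_display) (T : measurableType d) (R : realType).
Variables (Q : probability T R) (n : nat) (X : 'I_n -> T -> R).
Hypothesis mX : forall i, measurable_fun setT (X i).
Hypothesis indX : mutually_independent_rv Q X.
Variable mu : probability R R.
Hypothesis muX : forall i B, measurable B -> Q (X i @^-1` B) = mu B.
Hypothesis mu3 : rint mu (fun x => `|x| ^+ 3).
Hypothesis mu0 : Ex mu (fun x => x) = 0.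

Local Notation G := (grow (fun x : R => 1 + `|x|)).
Definition isum t : R := \sum_(i < n) X i t.
Local Notation S := isum.

Let rint_X i f : rint mu f -> rint Q (fun t => f (X i t)).
Proof.
move=> /integrableP[/measurable_EFinP mf fy].
pose Xi : {mfun T >-> R} := HB.pack (X i) (isMeasurableFun.Build _ _ _ _ _ (mX i)).
apply/integrableP; split.
  by apply/measurable_EFinP; exact: (measurableT_comp mf).
apply: le_lt_trans fy.
rewrite -(@ge0_integral_distribution _ _ _ _ _ Q Xi (fun x => `|(f x)%:E|%E))//.
  by rewrite (eq_measure_integral mu)// => A mA _; exact: muX.
by apply/measurable_EFinP; exact: measurableT_comp.
Qed.

Let b t : R := 1 + \sum_(i < n) `|X i t|.

Let b1 t : 1 <= b t.
Proof. by rewrite lerDl sumr_ge0. Qed.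

Let cube_le (x a : R) : 0 <= x -> 0 <= a -> (x + a) ^+ 3 <= 4 * (x ^+ 3 + a ^+ 3).
Proof.
move=> x0 a0; rewrite -subr_ge0.
have -> : 4 * (x ^+ 3 + a ^+ 3) - (x + a) ^+ 3 = 3 * (x + a) * (x - a) ^+ 2 by ring.
by rewrite mulr_ge0 ?sqr_ge0// mulr_ge0// addr_ge0.
Qed.

Let b3 : rint Q (fun t => b t ^+ 3).
Proof.
rewrite /b; elim: (index_enum _) => [|i s IH].
  by under eq_fun do rewrite big_nil; exact: rint_cst.
apply: (@rint_dom _ _ _ Q _ (fun t => 4 * ((1 + \sum_(i <- s) `|X i t|) ^+ 3 + `|X i t| ^+ 3))).
- apply: measurable_funX; apply: measurable_funD => //.
  by apply: measurable_sum => j; exact: measurableT_comp.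
- by apply: rintZ; apply: rintD => //; exact: (rint_X i mu3).
- move=> t; rewrite big_cons addrCA addrC ger0_norm; last first.
    by rewrite exprn_ge0// !addr_ge0// sumr_ge0.
  by apply: cube_le => //; rewrite addr_ge0// sumr_ge0.
Qed.

Let measurable_S : measurable_fun setT S.
Proof. exact: measurable_sum. Qed.

Let iQ j f : grow b j f -> (j <= 3)%N -> rint Q f.
Proof. by move=> + j3; exact: (grow_rint b1 b3). Qed.

Let gX i : grow b 1 (X i).
Proof.
split=> //; exists 1 => // t; rewrite mul1r expr1 /b (bigD1 i)//= addrCA lerDl.
by rewrite addr_ge0// sumr_ge0.
Qed.

Lemma grow_isum j f : G j f -> grow b j (fun t => f (S t)).
Proof.
move=> [mf [a a0 fa]]; split; first exact: measurableT_comp.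
exists a => // t; rewrite (le_trans (fa _))// ler_wpM2l//.
rewrite lerXn2r ?nnegrE ?addr_ge0//; first by rewrite sumr_ge0.
by rewrite lerD2l ler_norm_sum.
Qed.

Lemma rint_isum j f : G j f -> (j <= 3)%N -> rint Q (fun t => f (S t)).
Proof. by move=> /grow_isum; exact: iQ. Qed.

(** With the other summands frozen at [v], E(X_i p(S)) is an expectation under [mu] at the shift
    [v]; adding over [i] rebuilds S. The variance and both comparisons pass to the sum through this
    lemma. *)
Lemma isum_le p q c : G 2 p -> G 3 q ->
  (forall v, Ex mu (fun w => w * p (v + w)) <= Ex mu (fun w => q (v + w)) + c) ->
  Ex Q (fun t => S t * p (S t)) <= n%:R * (Ex Q (fun t => q (S t)) + c).
Proof.
move=> gp gq pq.
have iq : rint Q (fun t => q (S t)) by exact: (rint_isum gq).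
have iXp i : rint Q (fun t => X i t * p (S t)).
  exact: (iQ (growM (gX i) (grow_isum gp))).
have iX i : Ex Q (fun t => X i t * p (S t)) <= Ex Q (fun t => q (S t)) + c.
  pose f w v := q (v + w) + c - w * p (v + w).
  have fE t : f (X i t) (others X i t) = q (S t) + c - X i t * p (S t).
    by rewrite /f others_sum.
  have iwp v : rint mu (fun w => w * p (v + w)).
    exact: (law_int mu3 _ (growM (law_id R) (grow_shift v gp))).
  have iwq v : rint mu (fun w => q (v + w)) by exact: (law_int mu3 _ (grow_shift v gq)).
  have linE v : (fun w => f w v) = fun w => \sum_(r <- [:: (1, fun w => q (v + w));
     (c, fun=> 1); (-1, fun w => w * p (v + w))]) r.1 * r.2 w.
    by apply/funext => w; rewrite !big_cons big_nil /f /=; ring.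
  have linQ : (fun t => f (X i t) (others X i t)) = fun t => \sum_(r <- [::
     (1, fun t => q (S t)); (c, fun=> 1); (-1, fun t => X i t * p (S t))]) r.1 * r.2 t.
    by apply/funext => t; rewrite fE !big_cons big_nil /=; ring.
  have := @indep_expectation_ge0 _ _ _ Q n X mX indX mu i f (muX i).
  have allQ : all_rint Q [:: (1, fun t => q (S t)); (c, fun=> 1);
      (-1, fun t => X i t * p (S t))].
    by split; [exact: iq|split; [exact: rint_cst|split; [exact: iXp|]]].
  have allmu v : all_rint mu [:: (1, fun w => q (v + w)); (c, fun=> 1);
      (-1, fun w => w * p (v + w))].
    by split; [exact: iwq|split; [exact: rint_cst|split; [exact: iwp|]]].
  rewrite linQ Ex_lin//.
  rewrite !big_cons big_nil /= Ex_cst => H.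
  suff : 0 <= 1 * Ex Q (fun t => q (S t)) + (c * 1 +
     (-1 * Ex Q (fun t => X i t * p (S t)) + 0)) by lra.
  apply: H.
  - have [mp _] := gp; have [mq _] := gq.
    have ms : measurable_fun setT (fun z : R * R => z.2 + z.1) by exact: measurable_funD.
    apply: measurable_funB; last by apply: measurable_funM => //; exact: (measurableT_comp mp ms).
    by apply: measurable_funD => //; exact: (measurableT_comp mq ms).
  - exact: rint_lin.
  - by move=> v; rewrite linE; exact: rint_lin.
  - move=> v; rewrite linE Ex_lin//.
    by rewrite !big_cons big_nil /= Ex_cst; have := pq v; lra.
have -> : (fun t => S t * p (S t)) = fun t => \sum_(i < n) X i t * p (S t).
  by apply/funext => t; rewrite /S mulr_suml.
rewrite Ex_sum// (le_trans (ler_sum _ (fun i _ => iX i)))//.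
by rewrite sumr_const card_ord mulr_natl.
Qed.

Local Notation v := (variance2 mu).
Local Notation s2 := (n%:R * v).
Local Notation E := (Ex Q).

Let gi : G 1 (fun x => x) := @law_id R.
Let gp : G 1 (@posp R) := @law_pos R.
Let lb1 := @law_b1 R.

Let iS j f : G j f -> (j <= 3)%N -> rint Q (fun t => f (S t)).
Proof. exact: rint_isum. Qed.

Lemma isum_variance : E (fun t => S t ^+ 2) = s2.
Proof.
have ix2 : rint mu (fun x => x ^+ 2) by exact: (law_int mu3 _ (growX lb1 2 gi)).
have ix : rint mu (fun x => x) by exact: (law_int mu3 _ gi).
have EV w (c : R) : Ex mu (fun x => x * (c * (w + x))) = c * v.
  have := @Ex_lin _ _ _ mu [:: (c * w, fun x => x); (c, fun x => x ^+ 2)].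
  rewrite !big_cons !big_nil /= mu0 => H.
  transitivity (c * w * 0 + (c * v + 0)); last by ring.
  rewrite -H//; congr Ex; apply/funext => x; rewrite !big_cons big_nil /=; ring.
have iS2 : rint Q (fun t => S t ^+ 2) by exact: (iS (growX lb1 2 gi)).
have gc c : G 2 (fun x => c * x) by exact: (growW lb1 _ (growZ c gi)).
have gv c : G 3 (fun=> c) by exact: (growW lb1 _ (grow_cst _ c)).
have EQ c : E (fun t => S t * (c * S t)) = c * E (fun t => S t ^+ 2).
  by rewrite -ExZ//; congr Ex; apply/funext => t; ring.
(* Used at [c = 1] and [c = -1], which turns the inequality into an equality. *)
have H c : c * E (fun t => S t ^+ 2) <= c * s2.
  have -> : c * s2 = n%:R * (E (fun=> c * v) + 0) by rewrite Ex_cst; ring.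
  by rewrite -EQ; apply: (isum_le (gc c) (gv (c * v))) => w; rewrite EV Ex_cst addr0.
by apply/eqP; rewrite eq_le; have := H 1; have := H (-1); rewrite !mul1r !mulN1r lerN2 => -> ->.
Qed.

Lemma isum_swap h k L : measurable_fun setT h -> measurable_fun setT k ->
  c1_convex h k L ->
  E (fun t => S t * h (S t)) <= s2 * E (fun t => k (S t)) + L / 2 * (n%:R * pos3 mu).
Proof.
move=> mh mk hk.
have gh := c1_grow_h hk mh; have gk := c1_grow_k hk mk.
have iq : rint Q (fun t => k (S t)) by exact: (iS gk).
have gvk : G 3 (fun x => v * k x) by apply: growZ; exact: (growW lb1 _ gk).
have -> : s2 * E (fun t => k (S t)) + L / 2 * (n%:R * pos3 mu) =
    n%:R * (E (fun t => v * k (S t)) + L / 2 * pos3 mu) by rewrite ExZ//; ring.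
apply: (isum_le gh gvk) => w; rewrite ExZ; last exact: (law_int mu3 _ (grow_shift w gk)).
have hkw := c1_convex_shift hk w.
apply: (law_swap mu3 mu0 _ _ hkw); apply: measurableT_comp => //; exact: measurable_funD.
Qed.

Lemma isum_tail r : 0 < v ->
  s2 * E (fun t => (0 < S t - r)%R%:R) <= E (fun t => S t * tail mu (S t - r)).
Proof.
move=> v0.
have gt : G 1 (tail mu) := grow_tail mu3 v0.
have gtr : G 1 (fun x => tail mu (x - r)).
  have -> : (fun x => tail mu (x - r)) = fun x => tail mu (- r + x).
    by apply/funext => x; rewrite addrC.
  exact: grow_shift.
have gir : G 0 (fun x => (0 < x - r)%R%:R).
  by apply: (grow_gt0 (j := 1)); apply: growB => //; exact: (growW lb1 _ (grow_cst _ r)).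
have gp2 : G 2 (fun x => - tail mu (x - r)) by apply: growN; exact: (growW lb1 _ gtr).
have gq3 : G 3 (fun x => - v * (0 < x - r)%R%:R) by apply: growZ; exact: (growW lb1 _ gir).
have iqs : rint Q (fun t => (0 < S t - r)%R%:R) by exact: (iS gir).
have ips : rint Q (fun t => S t * tail mu (S t - r)) by exact: (iS (growM gi gtr)).
(* [isum_le] bounds from above, whereas [tail] is to be bounded from below: both sides change
   sign. *)
suff : E (fun t => S t * - tail mu (S t - r)) <=
    n%:R * (E (fun t => - v * (0 < S t - r)%R%:R) + 0).
  have -> : E (fun t => S t * - tail mu (S t - r)) = - 1 * E (fun t => S t * tail mu (S t - r)).
    by rewrite -ExZ//; congr Ex; apply/funext => t; ring.
  by rewrite ExZ//; lra.
apply: (isum_le gp2 gq3) => w; rewrite addr0 ExZ; last exact: (law_int mu3 _ (grow_shift w gir)).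
have := law_tail mu3 mu0 v0 (r - w).
have wE x : x - (r - w) = w + x - r by ring.
have -> : (fun x : R => (0 < x - (r - w))%R%:R) = fun x => (0 < w + x - r)%R%:R :> R.
  by apply/funext => x; rewrite wE.
have -> : (fun x => x * tail mu (x - (r - w))) = fun x => x * tail mu (w + x - r).
  by apply/funext => x; rewrite wE.
have -> : Ex mu (fun x => x * - tail mu (w + x - r)) =
    - 1 * Ex mu (fun x => x * tail mu (w + x - r)).
  rewrite -ExZ; first by congr Ex; apply/funext => x; ring.
  exact: (law_int mu3 _ (growM gi (grow_shift w gtr))).
by lra.
Qed.

Let v_ge0 : 0 <= v.
Proof. by apply: Ex_ge0 => x; exact: sqr_ge0. Qed.

Let pos3_ge0 : 0 <= pos3 mu.
Proof. by apply: Ex_ge0 => x; rewrite exprn_ge0// posp_ge0. Qed.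

Let neg3_ge0 : 0 <= neg3 mu.
Proof. by apply: Ex_ge0 => x; rewrite exprn_ge0// negp_ge0. Qed.

Let ip1 : rint Q (fun t => posp (S t)). Proof. exact: (iS gp). Qed.
Let ip2 : rint Q (fun t => posp (S t) ^+ 2). Proof. exact: (iS (growX lb1 2 gp)). Qed.
Let ip3 : rint Q (fun t => posp (S t) ^+ 3). Proof. exact: (iS (growX lb1 3 gp)). Qed.
Let iS2 : rint Q (fun t => S t ^+ 2). Proof. exact: (iS (growX lb1 2 gi)). Qed.
Let i1 : rint Q (fun=> 1). Proof. exact: rint_cst. Qed.

Let gir r : G 0 (fun x => (0 < x - r)%R%:R).
Proof.
by apply: (grow_gt0 (j := 1)); apply: growB => //; exact: (growW lb1 _ (grow_cst _ r)).
Qed.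

Let iir r : rint Q (fun t => (0 < S t - r)%R%:R).
Proof. exact: (iS (gir r)). Qed.

(** S_+^2 is half of S^2 + S|S|, and the Stein equation rewrites S|S| as an expression controlled by
    [isum_swap]. *)
Let isum_pos_square : 0 < s2 -> exists2 L, 0 <= L /\ L ^+ 2 * s2 <= 2 &
  E (fun t => posp (S t) ^+ 2) <= 1 / 2 * s2 + L / 4 * (n%:R * pos3 mu).
Proof.
move=> s0; have [K [k [L [mK mk hk KE Ls]]]] := stein_solution s0.
exists L; first by split=> //; exact: c1_lip_ge0 hk.
have gK := c1_grow_h hk mK; have gk := c1_grow_k hk mk.
have iK : rint Q (fun t => S t * K (S t)) by exact: (iS (growM gi gK)).
have ik : rint Q (fun t => k (S t)) by exact: (iS gk).
have := @Ex_lin _ _ _ Q [:: (1 / 2, fun t => S t ^+ 2); (1 / 2, fun t => S t * K (S t));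
  (- (1 / 2) * s2, fun t => k (S t))].
rewrite /= !big_cons !big_nil /= isum_variance => H.
have -> : (fun t => posp (S t) ^+ 2) = fun t => \sum_(r <- [:: (1 / 2, fun t => S t ^+ 2);
    (1 / 2, fun t => S t * K (S t)); (- (1 / 2) * s2, fun t => k (S t))]) r.1 * r.2 t.
  apply/funext => t; rewrite !big_cons big_nil /=; have := KE (S t).
  have [[? ->]|[? ->]] := posp_case (S t); first by rewrite ger0_norm//; lra.
  by rewrite ltr0_norm//; lra.
by rewrite H//; have := isum_swap mK mk hk; lra.
Qed.

(** The smooth comparison for x_+^2 / 2, whose derivative is 1-Lipschitz. *)
Let isum_pos_cube :
  E (fun t => posp (S t) ^+ 3) <= 2 * s2 * E (fun t => posp (S t)) + n%:R * pos3 mu.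
Proof.
have mp : measurable_fun setT (@posp R) by case: gp.
have mp2 : measurable_fun setT (fun x : R => posp x ^+ 2 / 2).
  by apply: measurable_funM => //; exact: measurable_funX.
have := isum_swap mp2 mp (posp_c1_convex R).
have -> : E (fun t => S t * (posp (S t) ^+ 2 / 2)) = 1 / 2 * E (fun t => posp (S t) ^+ 3).
  by rewrite -ExZ//; congr Ex; apply/funext => t; rewrite posp3E; field.
by lra.
Qed.

Let isum_tail_le M : 0 < v -> 0 < M -> neg3 mu + pos3 mu <= M * v ->
  s2 * E (fun t => (0 < S t - 2 * M)%R%:R) <=
  E (fun t => (S t ^+ 2 - 3 / 2 * (pos3 mu / v) * S t) * (0 < S t - 2 * M)%R%:R).
Proof.
move=> v0 M0 Mv; apply: (le_trans (isum_tail (2 * M) v0)).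
have gtr : G 1 (fun x => tail mu (x - 2 * M)).
  have -> : (fun x => tail mu (x - 2 * M)) = fun x => tail mu (- (2 * M) + x).
    by apply/funext => x; rewrite addrC.
  exact/grow_shift/grow_tail.
apply: Ex_le; first exact: (iS (growM gi gtr)).
  apply: (iS (j := 2) (f := fun x => (x ^+ 2 - 3 / 2 * (pos3 mu / v) * x) * (0 < x - 2 * M)%R%:R)) => //.
  apply: (growM (i := 2) (j := 0)) => //.
  by apply: growB; [exact: (growX lb1 2 gi)|apply: growZ; exact: (growW lb1 _ gi)].
move=> t; have tg := tail_ge0 mu3 v0 (S t - 2 * M).
have tl := tail_le mu3 v0 (S t - 2 * M).
have [[r0 iE]|[r0 iE]] := gt0_case (S t - 2 * M); rewrite iE in tl *; last first.
  rewrite mulr0; have tE : tail mu (S t - 2 * M) = 0.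
    apply/eqP; rewrite eq_le tg andbT.
    by move: tl; rewrite /posp (max_idPr r0) mulr0 addr0.
  by rewrite tE mulr0.
rewrite /posp (max_idPl (ltW r0)) mulr1 in tl; rewrite mulr1.
(* The only use of the threshold [2 * M]: it absorbs the excess of [tail] over [posp] and still
   leaves [3 / 2 * (pos3 mu / v)]. *)
have cM : (2 * neg3 mu + 1 / 2 * pos3 mu) / v + 3 / 2 * (pos3 mu / v) <= 2 * M.
  rewrite (_ : _ + _ = (2 * neg3 mu + 2 * pos3 mu) / v); last by field; rewrite gt_eqF.
  by rewrite ler_pdivrMr//; lra.
rewrite [leRHS](_ : _ = S t * (S t - 3 / 2 * (pos3 mu / v))); last by ring.
by rewrite ler_wpM2l//; lra.
Qed.

Lemma isum_median M : (0 < n)%N -> 0 < M -> neg3 mu + pos3 mu <= M * v ->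
  E (fun t => (0 < S t - 2 * M)%R%:R) <= 1 / 2.
Proof.
move=> n0 M0 Mv; set p := E _.
(* With zero variance the ratio [pos3 mu / v] is meaningless; Chebyshev's inequality at [2 * M] then
   gives [p <= 0]. *)
have [v0|v0] := leP v 0.
  have v_eq0 : v = 0 by apply/eqP; rewrite eq_le v0 v_ge0.
  have := @Ex_lin_ge0 _ _ _ Q [:: (1, fun t => S t ^+ 2);
    (- (4 * M ^+ 2), fun t => (0 < S t - 2 * M)%R%:R)].
  rewrite /= !big_cons !big_nil /= isum_variance v_eq0 mulr0 -/p => H.
  suff : 0 <= 1 * 0 + (- (4 * M ^+ 2) * p + 0).
    rewrite mulr0 add0r addr0 mulNr oppr_ge0 pmulr_rle0 ?mulr_gt0 ?exprn_gt0//.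
    by lra.
  apply: H => // t; rewrite !big_cons !big_nil /=.
  have [[r0 ->]|[r0 ->]] := gt0_case (S t - 2 * M); last by have := sqr_ge0 (S t); lra.
  have : 0 <= (S t - 2 * M) * (S t + 2 * M) by rewrite mulr_ge0; lra.
  by lra.
have s0 : 0 < s2 by rewrite mulr_gt0// ltr0n.
pose s := Num.sqrt s2.
have ss : s ^+ 2 = s2 by rewrite sqr_sqrtr// ltW.
pose m := pos3 mu / v.
have mE : n%:R * pos3 mu = s2 * m by rewrite /m; field; rewrite gt_eqF.
have [L [L0 Ls] e2] := isum_pos_square s0.
have e3 := isum_pos_cube.
have tl := isum_tail_le v0 M0 Mv; rewrite -/p -/m in tl.
have ii := iir (2 * M).
have m0 : 0 <= m by rewrite divr_ge0.
rewrite mE in e2 e3.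
apply: (@median_numerics R s M m (L * s2) (E (fun t => posp (S t))) p
  (E (fun t => posp (S t) ^+ 2)) (E (fun t => posp (S t) ^+ 3))) => //.
- by rewrite sqrtr_gt0.
- by rewrite ler_pdivrMr//; have := neg3_ge0; lra.
- by rewrite mulr_ge0// ltW.
- by rewrite ss; have := ler_wpM2r (ltW s0) Ls; lra.
- rewrite -[leRHS](Ex_cst Q 1); apply: Ex_le => // t.
  by have [[? ->]|[? ->]] := gt0_case (S t - 2 * M).
(* To pass from S > 2M to S_+, the complement is bounded by completing the square: x^2 - 3/2 m x is
   at least -9/16 m^2. *)
- rewrite ss; apply: (le_trans tl).
  have := @Ex_lin _ _ _ Q [:: (1, fun t => posp (S t) ^+ 2);
    (- (3 / 2 * m), fun t => posp (S t)); (9 / 16 * m ^+ 2, fun=> 1);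
    (- (9 / 16 * m ^+ 2), fun t => (0 < S t - 2 * M)%R%:R)].
  rewrite /= !big_cons !big_nil /= Ex_cst -/p => H.
  rewrite [leRHS](_ : _ = 1 * E (fun t => posp (S t) ^+ 2) +
    (- (3 / 2 * m) * E (fun t => posp (S t)) +
     (9 / 16 * m ^+ 2 * 1 + (- (9 / 16 * m ^+ 2) * p + 0)))); last by ring.
  rewrite -H//; apply: Ex_le.
  + apply: (iS (j := 2) (f := fun x => (x ^+ 2 - 3 / 2 * m * x) * (0 < x - 2 * M)%R%:R)) => //.
    apply: (growM (i := 2) (j := 0)) => //.
    by apply: growB; [exact: (growX lb1 2 gi)|apply: growZ; exact: (growW lb1 _ gi)].
  + by apply: rint_lin.
  + move=> t; rewrite !big_cons !big_nil /=.
    have [[r0 ->]|[r0 ->]] := gt0_case (S t - 2 * M).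
      have -> : posp (S t) = S t by apply/max_idPl; lra.
      by lra.
    by have := sqr_ge0 (posp (S t) - 3 / 4 * m); lra.
(* Here the gain is kept only as [3 / 2 * m * S >= 3 * m * M] on the event. *)
- rewrite ss; apply: (le_trans tl).
  have := @Ex_lin _ _ _ Q [:: (1, fun t => posp (S t) ^+ 2);
    (- (3 * m * M), fun t => (0 < S t - 2 * M)%R%:R)].
  rewrite /= !big_cons !big_nil /= -/p => H.
  rewrite [leRHS](_ : _ = 1 * E (fun t => posp (S t) ^+ 2) +
    (- (3 * m * M) * p + 0)); last by ring.
  rewrite -H//; apply: Ex_le.
  + apply: (iS (j := 2) (f := fun x => (x ^+ 2 - 3 / 2 * m * x) * (0 < x - 2 * M)%R%:R)) => //.
    apply: (growM (i := 2) (j := 0)) => //.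
    by apply: growB; [exact: (growX lb1 2 gi)|apply: growZ; exact: (growW lb1 _ gi)].
  + by apply: rint_lin.
  + move=> t; rewrite !big_cons !big_nil /=.
    have [[r0 ->]|[r0 ->]] := gt0_case (S t - 2 * M).
      have -> : posp (S t) = S t by apply/max_idPl; lra.
      have : 0 <= m * (S t - 2 * M) by rewrite mulr_ge0// ltW.
      by lra.
    by have := sqr_ge0 (posp (S t)); lra.
- by rewrite ss; lra.
- by rewrite ss; lra.
(* Interpolation between first and third moments, from [posp (S t) * (posp (S t) - 2 * c) ^+ 2 >=
   0]. *)
- move=> c c0; have := @Ex_lin_ge0 _ _ _ Q [:: (1, fun t => posp (S t) ^+ 3);
    (- (4 * c), fun t => posp (S t) ^+ 2); (4 * c ^+ 2, fun t => posp (S t))].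
  rewrite /= !big_cons !big_nil /= => H.
  suff : 0 <= 1 * E (fun t => posp (S t) ^+ 3) + (- (4 * c) * E (fun t => posp (S t) ^+ 2) +
    (4 * c ^+ 2 * E (fun t => posp (S t)) + 0)) by lra.
  apply: H => // t; rewrite !big_cons !big_nil /=.
  rewrite [leRHS](_ : _ = posp (S t) * (posp (S t) - 2 * c) ^+ 2); last by ring.
  by rewrite mulr_ge0 ?sqr_ge0// posp_ge0.
Qed.

End iid_sum.

(** * Probabilities as expectations, bounded variables, and the conclusion *)

Lemma Ex_indicator (d : measure_display) (T : measurableType d) (R : realType)
  (Q : probability T R) (f : T -> R) : measurable_fun setT f ->
  Ex Q (fun t => (0 < f t)%R%:R) = fine (Q [set t | 0 < f t]).
Proof.
move=> mf.
have mA : measurable [set t | 0 < f t].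
  have -> : [set t | 0 < f t] = setT `&` f @^-1` `]0, +oo[.
    by rewrite setTI; apply/seteqP; split=> t /=; rewrite in_itv/= andbT.
  exact: mf.
rewrite /Ex /Rintegral -[in RHS](setIT [set t | 0 < f t]) -integral_indic//.
congr (fine _); apply: eq_integral => t _; rewrite indicE; congr (_%:R%:E).
by congr nat_of_bool; apply/idP/idP; rewrite inE.
Qed.

Lemma bounded_moments (R : realType) (M : R) (d : measure_display) (T : measurableType d)
    (P : probability T R) (W : T -> R) : 0 < M ->
  measurable_fun setT W ->
  {ae P, forall x, `|W x| <= M} ->
  (\int[P]_x (`|W x| ^+ 3)%:E <= M%:E * \int[P]_x (W x ^+ 2)%:E)%E /\
  (\int[P]_x (W x ^+ 2)%:E < +oo)%E.
Proof.
move=> M0 mW WM.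
have m2 : measurable_fun setT (fun x => W x ^+ 2) by exact: measurable_funX.
have m3 : measurable_fun setT (fun x => `|W x| ^+ 3).
  by apply: measurable_funX; exact: measurableT_comp.
split.
  rewrite -ge0_integralZl//; [|exact/measurable_EFinP|
    by move=> x _; rewrite lee_fin sqr_ge0|by rewrite lee_fin ltW].
  apply: ae_ge0_le_integral.
  - exact: measurableT.
  - by move=> x _; rewrite lee_fin exprn_ge0.
  - exact/measurable_EFinP.
  - by move=> x _; rewrite -EFinM lee_fin mulr_ge0 ?sqr_ge0// ltW.
  - by apply/measurable_EFinP; exact: measurable_funM.
  - apply: filterS WM => x Wx _; rewrite -EFinM lee_fin exprS.
    by rewrite real_normK ?num_real// ler_wpM2r// sqr_ge0.
apply: (@le_lt_trans _ _ (\int[P]_x (M ^+ 2)%:E)%E); last first.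
  by rewrite integral_cst//= probability_setT mule1 ltry.
apply: ae_ge0_le_integral.
- exact: measurableT.
- by move=> x _; rewrite lee_fin sqr_ge0.
- exact/measurable_EFinP.
- by move=> x _; rewrite lee_fin sqr_ge0.
- exact: measurable_cst.
- apply: filterS WM => x Wx _; rewrite lee_fin -[leLHS]real_normK ?num_real//.
  by rewrite lerXn2r ?nnegrE// ltW.
Qed.

Theorem theorem1 (R : realType) (M : R) (hM : 0 < M) :
  (* main statement *)
  (forall (d : measure_display) (T : measurableType d) (P : probability T R)
          (W : T -> R),
      measurable_fun setT W ->
      P.-integrable setT (EFin \o W) ->
      (\int[P]_x (W x)%:E = 0)%E ->
      (\int[P]_x (`|W x| ^+ 3)%:E <= M%:E * \int[P]_x (W x ^+ 2)%:E)%E ->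
      (\int[P]_x (W x ^+ 2)%:E < +oo)%E ->
      forall (n : nat), (0 < n)%N ->
      forall (d' : measure_display) (T' : measurableType d')
             (Q : probability T' R) (X : 'I_n -> T' -> R),
        (forall i, measurable_fun setT (X i)) ->
        (forall i, same_distribution P W Q (X i)) ->
        mutually_independent_rv Q X ->
        ((1 / 2)%:E <=
           Q [set t | (n%:R^-1 * (\sum_(i < n) X i t) <= 2 * M / n%:R)%R])%E)
  /\
  (* "in particular": bounded centered W satisfy the moment assumption *)
  (forall (d : measure_display) (T : measurableType d) (P : probability T R)
          (W : T -> R),
      measurable_fun setT W ->
      (\int[P]_x (W x)%:E = 0)%E ->
      {ae P, forall x, `|W x| <= M} ->
      (\int[P]_x (`|W x| ^+ 3)%:E <= M%:E * \int[P]_x (W x ^+ 2)%:E)%E /\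
      (\int[P]_x (W x ^+ 2)%:E < +oo)%E).
Proof.
split=> [d T P W|d T P W mW _ WM]; last exact: bounded_moments.
move=> mW iW W0 W3 W2 n n0 d' T' Q X mX XW indX.
pose Wm : {mfun T >-> R} := HB.pack W (isMeasurableFun.Build _ _ _ _ _ mW).
(* All moments of [W] are moved to its law on the line, which is also the law of each [X i]; the
   sample space of [W] then disappears. *)
pose mu : probability R R := distribution P Wm.
have muX i B : measurable B -> Q (X i @^-1` B) = mu B by exact: XW.
have m2 : measurable_fun setT (fun x : R => x ^+ 2) by exact: measurable_funX.
have m3 : measurable_fun setT (fun x : R => `|x| ^+ 3).
  by apply: measurable_funX; exact: normr_measurable.
have mu2E : (\int[mu]_x (x ^+ 2)%:E = \int[P]_x (W x ^+ 2)%:E)%E.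
  rewrite (@ge0_integral_distribution _ _ _ _ _ P Wm (fun x => (x ^+ 2)%:E))//.
    exact/measurable_EFinP.
  by move=> x; rewrite lee_fin sqr_ge0.
have mu3E : (\int[mu]_x (`|x| ^+ 3)%:E = \int[P]_x (`|W x| ^+ 3)%:E)%E.
  rewrite (@ge0_integral_distribution _ _ _ _ _ P Wm (fun x => (`|x| ^+ 3)%:E))//.
  exact/measurable_EFinP.
have fin2 : (\int[P]_x (W x ^+ 2)%:E)%E \is a fin_num.
  by rewrite ge0_fin_numE//; apply: integral_ge0 => x _; rewrite lee_fin sqr_ge0.
have fin3 : (\int[P]_x (`|W x| ^+ 3)%:E)%E \is a fin_num.
  rewrite ge0_fin_numE; last by apply: integral_ge0 => x _; rewrite lee_fin exprn_ge0.
  by apply: (le_lt_trans W3); rewrite -(fineK fin2) -EFinM ltry.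
have mu3 : rint mu (fun x => `|x| ^+ 3).
  apply/integrableP; split; first exact/measurable_EFinP.
  under eq_integral do rewrite /= ger0_norm ?exprn_ge0//.
  by rewrite mu3E ltey_eq fin3.
have mu0 : Ex mu (fun x => x) = 0.
  have mid : measurable_fun setT (fun x : R => x%:E) by exact/measurable_EFinP.
  rewrite /Ex /Rintegral (@integral_distribution _ _ _ _ _ P Wm (fun x => x%:E))//.
  by rewrite /= W0.
have Mv : neg3 mu + pos3 mu <= M * variance2 mu.
  have -> : neg3 mu + pos3 mu = fine (\int[P]_x (`|W x| ^+ 3)%:E)%E.
    rewrite -mu3E -/(Rintegral _ _ _) -ExD.
    - apply: eq_Rintegral => x _.
      have [[x0 ->]|[x0 ->]] := posp_case x; have [[? ->]|[? ->]] := negp_case x;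
        rewrite ?(ger0_norm x0) ?(ltr0_norm x0); lra.
    - exact: (law_int mu3 _ (growX (@law_b1 R) 3 (@law_neg R))).
    - exact: (law_int mu3 _ (growX (@law_b1 R) 3 (@law_pos R))).
  rewrite /variance2 /Ex /Rintegral mu2E -lee_fin EFinM !fineK//.
have := isum_median mX indX muX mu3 mu0 n0 hM Mv.
set S := isum X.
have mS : measurable_fun setT (fun t => S t - 2 * M).
  by apply: measurable_funB => //; exact: measurable_sum.
rewrite Ex_indicator// => p2.
have mA : measurable [set t | 0 < S t - 2 * M].
  have -> : [set t | 0 < S t - 2 * M] = setT `&` (fun t => S t - 2 * M) @^-1` `]0, +oo[.
    by rewrite setTI; apply/seteqP; split=> t /=; rewrite in_itv/= andbT.
  exact: mS.
have -> : [set t | n%:R^-1 * (\sum_(i < n) X i t) <= 2 * M / n%:R] =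
    ~` [set t | 0 < S t - 2 * M].
  have E t : (n%:R^-1 * (\sum_(i < n) X i t) <= 2 * M / n%:R) = ~~ (0 < S t - 2 * M).
    by rewrite [leLHS]mulrC ler_pM2r ?invr_gt0 ?ltr0n// -leNgt subr_le0.
  by apply/seteqP; split=> t /=; rewrite E => /negP.
rewrite probability_setC// -(@fineK _ (Q _)) ?fin_num_measure// -EFinB lee_fin.
by lra.
Qed.
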